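(* Consider a robust MDP $(\mathcal{S},\mathcal{A},\boldsymbol{r},\mathcal{U},\boldsymbol{p}_0)$ whose uncertainty set $\mathcal{U}$ is sa-rectangular and compact. Then $$\sup_{\pi\in\Pi_{\sf H}}\ \inf_{\boldsymbol{P}\in\mathcal{U}_{\sf H}} R_{\sf avg}(\pi,\boldsymbol{P}) \;=\; \sup_{\pi\in\Pi_{\sf H}}\ \inf_{\boldsymbol{P}\in\mathcal{U}} R_{\sf avg}(\pi,\boldsymbol{P}).$$
   Context: A robust MDP (RMDP) is a tuple $(\mathcal{S},\mathcal{A},\boldsymbol{r},\mathcal{U},\boldsymbol{p}_0)$: $\mathcal{S}$ (states) and $\mathcal{A}$ (actions) are finite nonempty sets, $\boldsymbol{r}\in\mathbb{R}^{\mathcal{S}\times\mathcal{A}\times\mathcal{S}}$ is the reward function, the uncertainty set $\mathcal{U}\subset\Delta(\mathcal{S})^{\mathcal{S}\times\mathcal{A}}$ is a nonempty compact set of transition probabilities $\boldsymbol{P}=(\boldsymbol{p}_{sa})_{s,a}$, and $\boldsymbol{p}_0\in\Delta(\mathcal{S})$ is the initial distribution; $\Delta(\mathcal{S})$ is the simplex of probability distributions on $\mathcal{S}$. The set $\mathcal{U}$ is sa-rectangular if $\mathcal{U}=\prod_{(s,a)\in\mathcal{S}\times\mathcal{A}}\mathcal{U}_{sa}$ with $\mathcal{U}_{sa}\subseteq\Delta(\mathcal{S})$. $\Pi_{\sf H}$ is the set of history-dependent, possibly randomized policies of the decision maker (the distribution of the action $a_t$ may depend on $(s_0,a_0,\dots,s_t)$).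 The set $\mathcal{U}_{\sf H}$ of history-dependent adversaries consists of all maps from the set of finite histories $\bigcup_{t\in\mathbb{N}}\mathcal{H}_t$ to $\mathcal{U}$, where $\mathcal{H}_t$ is the set of sequences $(s_0,a_0,\boldsymbol{P}_0,s_1,a_1,\boldsymbol{P}_1,\dots,s_{t-1},a_{t-1},\boldsymbol{P}_{t-1},s_t)$ with $s_i\in\mathcal{S}$, $a_i\in\mathcal{A}$, $\boldsymbol{P}_i\in\mathcal{U}$; the transition probabilities used at period $t$ are those assigned by the map to the current history. Elements of $\mathcal{U}$ are identified with constant maps (stationary adversaries), so $\mathcal{U}\subset\mathcal{U}_{\sf H}$. $\mathbb{E}_{\pi,\boldsymbol{P}}$ is expectation with respect to the law of $(s_t,a_t)_{t\ge0}$ induced by $\pi\in\Pi_{\sf H}$ and $\boldsymbol{P}\in\mathcal{U}_{\sf H}$. The average return is $$R_{\sf avg}(\pi,\boldsymbol{P})=\mathbb{E}_{\pi,\boldsymbol{P}}\Big[\limsup_{T\to+\infty}\tfrac{1}{T+1}\sum_{t=0}^{T} r_{s_ta_ts_{t+1}}\ \Big|\ s_0\sim\boldsymbol{p}_0\Big].$$ *)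

(* Defs.v *)
From HB Require Import structures.
From mathcomp Require Import all_boot all_order all_algebra.
From mathcomp Require Import all_classical all_reals all_analysis.
Set Implicit Arguments.
Unset Strict Implicit.
Unset Printing Implicit Defensive.
Import Order.TTheory GRing.Theory Num.Theory.
Import numFieldTopology.Exports numFieldNormedType.Exports.
Local Open Scope classical_set_scope.
Local Open Scope ring_scope.

Definition simplex (R : realType) (T : finType) : set {ptws T -> R} :=
  [set p | (forall x, 0 <= p x) /\ \sum_x p x = 1].
Arguments simplex : clear implicits.

(* {ptws _ -> _} carries the topology of pointwise convergence, which on these
   finite index sets is the Euclidean topology. *)
Definition transitions (R : realType) (S A : finType) :=
  {ptws S * A -> {ptws S -> R}}.

Record rmdp (R : realType) := RMDP {
  state : finType;
  action : finType;
  state_gt0 : (0 < #|state|)%N;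
  action_gt0 : (0 < #|action|)%N;
  reward : state -> action -> state -> R;
  uset : set (transitions R state action);
  uset_simplex : uset `<=` [set P | forall sa, simplex R state (P sa)];
  uset_neq0 : uset !=set0;
  init : {ptws state -> R};
  init_simplex : simplex R state init }.
Arguments reward {R} M : rename.
Arguments uset {R} M : rename.
Arguments init {R} M : rename.

Definition sa_rectangular (R : realType) (M : rmdp R) : Prop :=
  exists Usa : state M -> action M -> set {ptws state M -> R},
    (forall s a, Usa s a `<=` simplex R (state M)) /\
    uset M = [set P | forall s a, Usa s a (P (s, a))].

Section histories.
Context (R : realType) (M : rmdp R).

Record policy := Policy {
  policy_fun :> seq (state M * action M) * state M -> {ptws action M -> R};
  policy_simplex : forall h, simplex R (action M) (policy_fun h) }.

Definition nature : Type := set_type (uset M).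

(* ((s_0, a_0, P_0), ..., (s_{t-1}, a_{t-1}, P_{t-1})) followed by s_t *)
Definition history : Type := (seq (state M * action M * nature) * state M)%type.

Definition adversary : Type := history -> nature.

Definition stationary (P : nature) : adversary := fun _ => P.

Definition traj := nat -> state M * action M.

(* The matrices occurring in the history are the ones the adversary itself
   chose earlier along the trajectory. *)
Fixpoint past (P : adversary) (w : traj) (t : nat) :
    seq (state M * action M * nature) :=
  if t is t'.+1 then
    rcons (past P w t') (w t', P (past P w t', (w t').1))
  else [::].

Definition transition_at (P : adversary) (w : traj) (t : nat) : nature :=
  P (past P w t, (w t).1).

Definition action_at (pi : policy) (w : traj) (t : nat) : {ptws action M -> R} :=
  pi (mkseq w t, (w t).1).

Definition path_prob (pi : policy) (P : adversary) (w : traj) (t : nat) : R :=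
  init M (w 0%N).1 *
  (\prod_(i < t.+1) action_at pi w i (w i).2) *
  \prod_(i < t) val (transition_at P w i) (w i) (w i.+1).1.

Lemma sa_gt0 : (0 < #|{: state M * action M}|)%N.
Proof. by rewrite card_prod muln_gt0 state_gt0 action_gt0. Qed.

Definition sa_point : state M * action M := enum_val (Ordinal sa_gt0).

HB.instance Definition _ := Choice.on traj.
HB.instance Definition _ := isPointed.Build traj (fun _ => sa_point).

Definition coord_sets : set (set traj) :=
  [set C | exists t (B : set (state M * action M)), C = [set w | B (w t)]].

Definition path_space := g_sigma_algebraType coord_sets.

Definition is_law (pi : policy) (P : adversary) (mu : probability path_space R) :=
  forall (w : traj) (t : nat),
    mu [set v : traj | forall i, (i <= t)%N -> v i = w i] =
    (path_prob pi P w t)%:E.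

End histories.
Arguments coord_sets {R} M.

(* Existence of the law of the process with conditional probabilities k
   (Ionescu-Tulcea for a finite alphabet): [0, 1[ is split into nested
   intervals J w n of length len w n, one for each prefix of length n, and
   Lebesgue measure is pushed forward along the map X sending u to the
   trajectory whose prefix intervals contain u. *)
Section path_measure.
Context (R : realType) (M : rmdp R).
Let I : finType := (state M * action M)%type.
Variable k : (nat -> I) -> nat -> I -> R.
Hypothesis k_ge0 : forall w n x, 0 <= k w n x.
Hypothesis k_sum : forall w n, \sum_x k w n x = 1.
Hypothesis k_loc : forall w w' n,
  (forall i, (i < n)%N -> w i = w' i) -> k w n = k w' n.

Let x0 : I := sa_point M.
Let len (w : nat -> I) n : R := \prod_(t < n) k w t (w t).
Let cum (w : nat -> I) n m : R := \sum_(0 <= j < m) k w n (nth x0 (enum I) j).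
Let lo (w : nat -> I) n : R :=
  \sum_(t < n) len w t * cum w t (index (w t) (enum I)).
Let agree n (w w' : nat -> I) := forall i, (i < n)%N -> w i = w' i.
Let J w n (u : R) := lo w n <= u < lo w n + len w n.

Let agreeS n w w' : agree n.+1 w w' -> agree n w w'.
Proof. by move=> h i ni; apply: h; apply: ltnW. Qed.

Let agree_sym n w w' : agree n w w' -> agree n w' w.
Proof. by move=> h i /h. Qed.

Let len_loc n w w' : agree n w w' -> len w n = len w' n.
Proof.
move=> h; apply: eq_bigr => t _; rewrite h//.
by rewrite (@k_loc w w')// => i it; apply: h; apply: ltn_trans it _.
Qed.

Let cum_loc n w w' m : agree n w w' -> cum w n m = cum w' n m.
Proof. by move=> h; apply: eq_bigr => t _; rewrite (@k_loc w w'). Qed.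

Let lo_loc n w w' : agree n w w' -> lo w n = lo w' n.
Proof.
move=> h; apply: eq_bigr => t _.
have ht : agree t w w' by move=> i it; apply: h; apply: ltn_trans it _.
by rewrite (len_loc ht) (cum_loc _ ht) h.
Qed.

Let J_loc n w w' u : agree n w w' -> J w n u = J w' n u.
Proof. by move=> h; rewrite /J (lo_loc h) (len_loc h). Qed.

Let len_ge0 w n : 0 <= len w n.
Proof. exact: prodr_ge0. Qed.

Let lenS w n : len w n.+1 = len w n * k w n (w n).
Proof. by rewrite /len big_ord_recr. Qed.

Let loS w n : lo w n.+1 = lo w n + len w n * cum w n (index (w n) (enum I)).
Proof. by rewrite /lo big_ord_recr. Qed.

Let cum0 w n : cum w n 0 = 0.
Proof. by rewrite /cum big_geq. Qed.

Let cumS w n m : cum w n m.+1 = cum w n m + k w n (nth x0 (enum I) m).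
Proof. by rewrite /cum big_nat_recr. Qed.

Let cum_max w n : cum w n #|I| = 1.
Proof.
rewrite -(k_sum w n) /cum cardE -(big_nth x0 xpredT (k w n)).
by rewrite big_enum.
Qed.

Let cum_mono w n m m' : (m <= m')%N -> cum w n m <= cum w n m'.
Proof.
move=> /subnK <-; elim: (m' - m)%N => [|d IH]; first by rewrite add0n.
by rewrite addSn cumS (le_trans IH)// lerDl.
Qed.

Let Jidx w n u : J w n.+1 u =
  (lo w n + len w n * cum w n (index (w n) (enum I)) <= u <
   lo w n + len w n * cum w n (index (w n) (enum I)).+1).
Proof.
rewrite /J loS lenS cumS nth_index ?mem_enum//.
by rewrite -addrA -mulrDr.
Qed.

Let JS w n u : J w n.+1 u -> J w n u.
Proof.
rewrite Jidx => /andP[h1 h2]; apply/andP; split.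
  apply: le_trans h1; rewrite lerDl mulr_ge0//.
  by rewrite -(cum0 w n); apply: cum_mono.
apply: lt_le_trans h2 _; rewrite lerD2l -[leRHS]mulr1 ler_wpM2l//.
rewrite -(cum_max w n); apply: cum_mono.
by rewrite cardE index_mem mem_enum.
Qed.

Let J_inj n w w' u : J w n u -> J w' n u -> agree n w w'.
Proof.
elim: n => [//|n IH] h h'.
have hn := IH (JS h) (JS h').
move: h h'; rewrite !Jidx -(lo_loc hn) -(len_loc hn) -!(cum_loc _ hn).
set a := index (w n) _; set b := index (w' n) _ => /andP[h1 h2] /andP[h3 h4].
have E : a = b.
  apply/eqP; rewrite eqn_leq; apply/andP; split; rewrite leqNgt; apply/negP => l.
    have := le_lt_trans h1 h4; rewrite ltNge => /negP; apply.
    by rewrite lerD2l ler_wpM2l// cum_mono.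
  have := le_lt_trans h3 h2; rewrite ltNge => /negP; apply.
  by rewrite lerD2l ler_wpM2l// cum_mono.
move=> i; rewrite ltnS leq_eqVlt => /orP[/eqP ->|/hn//].
by rewrite -(nth_index x0 (mem_enum I (w n))) -/a E nth_index// mem_enum.
Qed.

Let upd (w : nat -> I) n x := fun t => if t == n then x else w t.

Let upd_agree w n x : agree n (upd w n x) w.
Proof. by move=> i ni; rewrite /upd ltn_eqF. Qed.

Let J_ex w n u : J w n u -> exists x, J (upd w n x) n.+1 u.
Proof.
move=> /andP[h1 h2].
have ex : exists m, u < lo w n + len w n * cum w n m.
  by exists #|I|; rewrite cum_max mulr1.
case: (ex_minnP ex) => -[|m] hm mmin.
  by move: hm; rewrite cum0 mulr0 addr0 ltNge h1.
have mI : (m < #|I|)%N.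
  rewrite ltnNge; apply/negP => Im.
  have := mmin #|I|; rewrite cum_max mulr1 h2 => /(_ isT).
  by move=> /(leq_trans _) - /(_ m.+1 (leqnn _)); rewrite ltnNge Im.
exists (nth x0 (enum I) m).
rewrite Jidx (lo_loc (upd_agree _ _)) (len_loc (upd_agree _ _)).
rewrite !(cum_loc _ (upd_agree _ _)) {1 2}/upd eqxx.
rewrite index_uniq ?enum_uniq -?cardE// hm andbT.
rewrite leNgt; apply/negP => /mmin.
by rewrite ltnn.
Qed.

Let W (u : R) := fix W (n : nat) : nat -> I :=
  if n is n'.+1 then upd (W n') n' (odflt x0 [pick x | J (upd (W n') n' x) n'.+1 u])
  else fun=> x0.

Let clamp (u : R) : R := if 0 <= u < 1 then u else 0.

Let X (u : R) : path_space M := fun t => W (clamp u) t.+1 t.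

Let XW u n : agree n (X u) (W (clamp u) n).
Proof.
elim: n => // n IH i; rewrite ltnS leq_eqVlt => /orP[/eqP ->//|ni].
by rewrite IH//= /upd ltn_eqF.
Qed.

Let clamp01 u : 0 <= clamp u < 1.
Proof. by rewrite /clamp; case: ifP => // _; rewrite lexx ltr01. Qed.

Let XJ u n : J (X u) n (clamp u).
Proof.
rewrite (J_loc _ (@XW u n)); elim: n => [|n IH].
  by rewrite /J /lo /len !big_ord0 add0r clamp01.
rewrite /=; case: pickP => [x //|h].
by have [x] := J_ex IH; rewrite h.
Qed.

Let XE u n w : agree n (X u) w <-> J w n (clamp u).
Proof.
split => [h|h]; first by rewrite -(J_loc _ h) XJ.
exact: (J_inj (XJ u n) h).
Qed.

Let J01 w n u : J w n u -> 0 <= u < 1.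
Proof.
elim: n => [|n IH]; first by rewrite /J /lo /len !big_ord0 add0r.
by move/JS.
Qed.

Let unit_itv : set R := `[0, 1[%classic.
Let munit_itv : measurable unit_itv. Proof. exact: measurable_itv. Qed.

Let mclamp : measurable_fun [set: R] clamp.
Proof.
apply: measurable_fun_ifT => //.
apply: (measurable_fun_bool true).
rewrite setTI (_ : _ @^-1` _ = unit_itv); first exact: munit_itv.
by apply/seteqP; split => x; rewrite /= /unit_itv /= in_itv.
Qed.

Let mJ w n : measurable [set u | J w n (clamp u)].
Proof.
rewrite (_ : [set _ | _] = clamp @^-1` `[lo w n, lo w n + len w n[%classic).
  by rewrite -[X in measurable X]setTI; apply: mclamp => //; exact: measurable_itv.
by apply/seteqP; split => x; rewrite /= in_itv.
Qed.

Let mX : measurable_fun [set: R] X.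
Proof.
refine (@measurability _ _ _ (path_space M) setT X (coord_sets M) erefl _).
move=> _ [_ [t [B ->]] <-]; rewrite setTI.
rewrite (_ : _ @^-1` _ = \bigcup_(s in [set s : t.+1.-tuple I | B (nth x0 s t)])
    [set u | J (nth x0 s) t.+1 (clamp u)]).
  apply: fin_bigcup_measurable => [|s _]; [exact: finite_finset|exact: mJ].
apply/seteqP; split => u /=.
  move=> Bu; have sz : size (mkseq (X u) t.+1) == t.+1 by rewrite size_mkseq.
  exists (Tuple sz) => /=; first by rewrite nth_mkseq.
  by apply/XE => i it; rewrite nth_mkseq.
by move=> [s /= Bs /XE h]; rewrite h.
Qed.

Let P01 : {measure set (measurableTypeR R) -> \bar R} := mrestr lebesgue_measure munit_itv.

Let P01T : P01 setT = 1%E.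
Proof.
rewrite /P01 /= /mrestr setTI.
by rewrite lebesgue_measure_itv /= lte_fin ltr01 oppr0 adde0.
Qed.

Let P01prob : probability (measurableTypeR R) R :=
  HB.pack (Measure.sort P01) (Measure_isProbability.Build _ _ _ P01 P01T).

Let Xmfun : {mfun (measurableTypeR R) >-> path_space M} :=
  HB.pack X (isMeasurableFun.Build _ _ (measurableTypeR R) _ X mX).

Lemma path_measure_ex : exists mu : probability (path_space M) R,
  forall w n, mu [set v : traj M | forall i, (i < n)%N -> v i = w i] =
              (\prod_(t < n) k w t (w t))%:E.
Proof.
exists (distribution P01prob Xmfun) => w n.
rewrite /distribution /pushforward /= /mrestr.
rewrite (_ : _ `&` _ = `[lo w n, lo w n + len w n[%classic).
  rewrite lebesgue_measure_itv /= lte_fin ltrDl lt_neqAle len_ge0 andbT eq_sym.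
  rewrite -/(len w n); case: eqP => [->//|_] /=.
  by rewrite -EFinD addrAC subrr add0r.
apply/seteqP; split => u /=; rewrite /unit_itv /= !in_itv /=.
  by move=> [/XE + u01]; rewrite /clamp u01.
by move=> Ju; have u01 := J01 Ju; split => //; apply/XE; rewrite /clamp u01.
Qed.

End path_measure.

Section law.
Context (R : realType) (M : rmdp R) (pi : policy M) (P : adversary M).

Let I : finType := (state M * action M)%type.

Let step (w : traj M) (n : nat) (x : I) : R :=
  (if n is m.+1 then val (transition_at P w m) (w m) x.1 else init M x.1) *
  pi (mkseq w n, x.1) x.2.

Let step_ge0 w n x : 0 <= step w n x.
Proof.
apply: mulr_ge0; last exact: (policy_simplex pi _).1.
case: n => [|n]; first exact: (init_simplex M).1.
have /set_mem := valP (transition_at P w n).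
by move=> /(uset_simplex (r:=M)) /(_ (w n)) [].
Qed.

Let step_sum w n : \sum_x step w n x = 1.
Proof.
rewrite -(pair_bigA _ (fun s a =>
  (if n is m.+1 then val (transition_at P w m) (w m) s else init M s) *
  pi (mkseq w n, s) a)) /=.
under eq_bigr do rewrite -big_distrr /= (policy_simplex pi _).2 mulr1.
case: n => [|n]; first exact: (init_simplex M).2.
have /set_mem := valP (transition_at P w n).
by move=> /(uset_simplex (r:=M)) /(_ (w n)) [].
Qed.

Let past_loc w w' n : (forall i, (i < n)%N -> w i = w' i) ->
  past P w n = past P w' n.
Proof.
elim: n => //= n IH h; rewrite IH ?h// => i ni.
by apply: h; apply: ltnW.
Qed.

Let mkseq_loc w w' n : (forall i, (i < n)%N -> w i = w' i) ->
  mkseq w n = mkseq w' n :> seq I.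
Proof.
move=> h; apply/eq_in_map => i; rewrite mem_iota add0n => /andP[_]; exact: h.
Qed.

Let step_loc w w' n : (forall i, (i < n)%N -> w i = w' i) ->
  step w n = step w' n.
Proof.
move=> h; apply/funext => x; rewrite /step (mkseq_loc h); congr (_ * _).
case: n h => // n h; rewrite /transition_at h//.
by rewrite (@past_loc w w')// => i ni; apply: h; apply: ltnW.
Qed.

Let step_prod w t : \prod_(i < t.+1) step w i (w i) = path_prob pi P w t.
Proof.
rewrite /path_prob; elim: t => [|t IH].
  by rewrite !big_ord_recr !big_ord0 /= mul1r mulr1 mul1r.
rewrite big_ord_recr /= IH [X in _ = _ * X * _]big_ord_recr.
rewrite [X in _ = _ * X]big_ord_recr /=.
rewrite /step /action_at -!mulrA; do 2![congr (_ * _)].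
by rewrite mulrA mulrC.
Qed.

Lemma law_ex : exists mu : probability (path_space M) R, is_law pi P mu.
Proof.
have [mu mu_k] := path_measure_ex step_ge0 step_sum step_loc.
by exists mu => w t; rewrite -step_prod -(mu_k w t.+1).
Qed.

Lemma law_unique (mu nu : probability (path_space M) R) :
  is_law pi P mu -> is_law pi P nu ->
  forall E : set (path_space M), measurable E -> mu E = nu E.
Proof.
move=> hmu hnu E mE.
pose cyl (w : traj M) n : set (path_space M) :=
  [set v | forall i, (i < n)%N -> v i = w i].
pose G : set (set (path_space M)) :=
  [set C | C = set0 \/ exists w n, C = cyl w n].
have cyl0 w : cyl w 0 = setT by apply/seteqP; split => // v _ i.
have mcoord t (B : set I) : measurable ([set v | B (v t)] : set (path_space M)).
  by apply: sub_sigma_algebra; exists t, B.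
have mcyl w n : measurable (cyl w n).
  rewrite (_ : cyl w n = \bigcap_(i in `I_n) [set v | [set w i] (v i)]).
    by apply: fin_bigcap_measurable => // i _; exact: mcoord.
  by apply/seteqP; split.
have GE : measurable = <<s G >> :> set (set (path_space M)).
  apply/seteqP; split.
    apply: smallest_sub; first exact: smallest_sigma_algebra.
    move=> _ [t [B ->]].
    rewrite (_ : [set _ | _] =
      \bigcup_(s in [set s : t.+1.-tuple I | B (nth (sa_point M) s t)])
        cyl (nth (sa_point M) s) t.+1).
      apply: (@fin_bigcup_measurable _ (g_sigma_algebraType G)) => // s _.
      by apply: sub_sigma_algebra; right; exists (nth (sa_point M) s), t.+1.
    apply/seteqP; split => v /=.
      move=> Bv; have sz : size (mkseq v t.+1) == t.+1 by rewrite size_mkseq.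
      exists (Tuple sz) => /=; first by rewrite nth_mkseq.
      by move=> i it; rewrite nth_mkseq.
    by move=> [s /= Bs h]; rewrite h.
  apply: smallest_sub; first exact: sigma_algebra_measurable.
  by move=> C [->|[w [n ->]]]; [exact: measurable0 | exact: mcyl].
have GI : setI_closed G.
  suff H w n w' n' : (n <= n')%N -> G (cyl w n `&` cyl w' n').
    move=> C D [->|[w [n ->]]]; first by rewrite set0I; left.
    move=> [->|[w' [n' ->]]]; first by rewrite setI0; left.
    by have [/H//|/ltnW/H] := leqP n n'; rewrite setIC.
  move=> nn'; have [h|h] := pselect (forall i, (i < n)%N -> w' i = w i).
    right; exists w', n'; apply/seteqP; split => [v []//|v hv]; split=> // i ni.
    by rewrite hv ?h// (leq_trans ni).
  left; apply/seteqP; split => // v [hv hv']; apply: h => i ni.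
  by rewrite -hv// hv'// (leq_trans ni).
apply: (@measure_unique _ _ _ G (fun=> setT) GE GI) => //.
- by move=> _; right; exists (fun=> sa_point M), 0%N; rewrite cyl0.
- by apply/seteqP; split => // v _; exists 0%N.
- move=> _ [->|[w [[|n] ->]]]; first by rewrite !measure0.
    by rewrite cyl0 [LHS]probability_setT [RHS]probability_setT.
  by rewrite [LHS]hmu [RHS]hnu.
- by move=> _; rewrite [X in (X < _)%E]probability_setT ltry.
Qed.

Definition law : probability (path_space M) R := projT1 (cid law_ex).

Lemma lawP : is_law pi P law.
Proof. exact: (projT2 (cid law_ex)). Qed.

End law.

(* The integrand is bounded by the largest absolute value of a reward, so the
   extended-real limsup and integral are finite. *)
Definition Ravg (R : realType) (M : rmdp R) (pi : policy M) (P : adversary M) :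
    \bar R :=
  (\int[law pi P]_w limn_esup (fun T : nat =>
     ((\sum_(t < T.+1) reward M (w t).1 (w t).2 (w t.+1).1) / T.+1%:R)%:E))%E.

(* Main.v *)
(* A gain [g] and biases [h] certify values: a stationary [sigma] whose rows,
   whatever nature does, satisfy [g <= p.g] and [g + h - e <= p.(r + h)]
   guarantees [p0.g] against every history-dependent adversary (take
   expectations and use dominated convergence), while a stationary [P] with the
   reverse inequalities caps every policy at [p0.g].  The cap is pathwise: the
   gain along the trajectory has summable expected jumps, and the accumulated
   excess reward is controlled by an exponential supermartingale.

   When nature has finitely many matrices, both certificates exist with the same
   [g]: along discount rates tending to 0, one pair of stationary strategies is
   optimal infinitely often, [g] is a cluster point of the discounted values
   [v] and [v / l] is the bias.  In the compact case, let [g] be the infimum of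
   these values over finite subsets of [U]; finite sets already provide
   near-optimal caps.  As there are finitely many policies, one [sigma] is
   optimal for cofinally many finite sets, so that every single [P] in [U] has
   a bias against [sigma].  Discounted best replies to [sigma] cluster at some
   [P0] in [U], and the bias of [P0] shows that their values stay above
   [g - e]; rescaled, they are the uniform bias needed to certify [g]. *)
Require Import Defs.
From mathcomp Require Import all_boot all_order all_algebra.
From mathcomp Require Import all_classical all_reals all_analysis.
From mathcomp Require Import measurable_realfun ring lra zify.
Import numFieldTopology.Exports numFieldNormedType.Exports.
Local Open Scope classical_set_scope.
Import Order.TTheory GRing.Theory Num.Theory.
Local Open Scope ring_scope.

Set Implicit Arguments.
Unset Strict Implicit.
Unset Printing Implicit Defensive.

(** * Discounted games *)

(** Knaster-Tarski on the box of radius [B]: [v] is the pointwise supremum of the subsolutions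
    [u <= T u], and [T v] is again one of them. *)
Lemma monotone_fixpoint (R : realType) (S : Type) (T : (S -> R) -> S -> R)
    (B : R) :
  (forall u v, (forall s, u s <= v s) -> forall s, T u s <= T v s) ->
  (forall u, (forall s, `|u s| <= B) -> forall s, `|T u s| <= B) ->
  0 <= B ->
  exists v : S -> R, (forall s, `|v s| <= B) /\ forall s, T v s = v s.
Proof.
move=> Tmono Tbox B0.
pose D := [set u : S -> R | (forall s, `|u s| <= B) /\ forall s, u s <= T u s].
have D0 : D (fun=> - B).
  have b (s : S) : `|(fun=> - B : R) s| <= B by rewrite normrN ger0_norm.
  split=> // s; have := Tbox _ b s.
  by rewrite ler_norml => /andP[].
pose E s := [set u s | u in D].
have Ene s : E s !=set0 by exists (- B), (fun=> - B).
have Eub s : ubound (E s) B.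
  by move=> _ [u [ub _] <-]; have := ub s; rewrite ler_norml => /andP[].
pose v s := sup (E s).
have Dv u : D u -> forall s, u s <= v s.
  by move=> Du s; apply: ub_le_sup; [exists B; exact: Eub | exists u].
have vB s : `|v s| <= B.
  rewrite ler_norml (Dv _ D0)/=; apply: ge_sup => //; exact: Eub.
have vT s : v s <= T v s.
  apply: ge_sup => // _ [u Du <-].
  apply: le_trans (Du.2 s) _; apply: Tmono; exact: Dv.
exists v; split=> // s; apply/eqP; rewrite eq_le vT andbT.
apply: (Dv (T v)); split=> [|{}s]; first exact: Tbox.
exact: Tmono.
Qed.

(** * Averages of functions under a probability vector *)

Section dot.
Context (R : realType) (S : finType).
Implicit Types (p f g : S -> R).

Definition dot p f : R := \sum_s p s * f s.

Lemma dot_lin p (a b : R) f g :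
  dot p (fun s => a * f s + b * g s) = a * dot p f + b * dot p g.
Proof.
rewrite /dot !mulr_sumr -big_split /=; apply: eq_bigr => s _; ring.
Qed.

Lemma dotD p f g : dot p (fun s => f s + g s) = dot p f + dot p g.
Proof. by rewrite /dot -big_split; apply: eq_bigr => s _; rewrite mulrDr. Qed.

Lemma dotZ p (a : R) f : dot p (fun s => a * f s) = a * dot p f.
Proof. by rewrite /dot mulr_sumr; apply: eq_bigr => s _; rewrite mulrCA. Qed.

Lemma dot_cst p (c : R) : simplex R S p -> dot p (fun=> c) = c.
Proof. by move=> [_ p1]; rewrite /dot -mulr_suml p1 mul1r. Qed.

Lemma dot_le p f g : simplex R S p -> (forall s, f s <= g s) ->
  dot p f <= dot p g.
Proof. by move=> [p0 _] fg; apply: ler_sum => s _; rewrite ler_wpM2l. Qed.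

Lemma dot_le_add p f g (e : R) : simplex R S p -> (forall s, f s <= g s + e) ->
  dot p f <= dot p g + e.
Proof.
move=> sp fg; rewrite -[X in _ + X](dot_cst e sp) -dotD; exact: dot_le.
Qed.

Lemma dot_norm p f (B : R) : simplex R S p -> (forall s, `|f s| <= B) ->
  `|dot p f| <= B.
Proof.
move=> sp fB; rewrite ler_norml; apply/andP; split.
  rewrite -[leLHS](dot_cst _ sp); apply: dot_le => // s.
  by have := fB s; rewrite ler_norml => /andP[].
rewrite -[leRHS](dot_cst _ sp); apply: dot_le => // s.
by have := fB s; rewrite ler_norml => /andP[].
Qed.

Lemma dot_near p p' f (e H : R) : (forall s, `|p s - p' s| <= e) ->
  (forall s, `|f s| <= H) -> `|dot p f - dot p' f| <= #|S|%:R * (e * H).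
Proof.
move=> pe fH; rewrite /dot -sumrB (le_trans (ler_norm_sum _ _ _))//.
rewrite [leRHS](_ : _ = \sum_(s : S) e * H); last first.
  by rewrite sumr_const mulr_natl.
by apply: ler_sum => s _; rewrite -mulrBl normrM ler_pM.
Qed.

End dot.

(* The value of the discounted zero-sum game in which the decision maker picks
   [a] and nature then picks a law in [K s a]; nature may have no optimal
   answer, hence the slack [eta]. *)
Lemma discounted_game (R : realType) (S A : finType) (a0 : A)
    (r : S -> A -> S -> R) (K : S -> A -> set (S -> R)) (l eta B : R) :
  (forall s a, K s a !=set0) -> (forall s a, K s a `<=` simplex R S) ->
  (forall s a s', `|r s a s'| <= B) -> 0 < l < 1 -> 0 < eta ->
  exists (v : S -> R) (sigma : S -> A) (P : S -> A -> S -> R),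
  [/\ forall s, `|v s| <= B,
      forall s a, K s a (P s a),
      forall s p, K s (sigma s) p ->
        v s <= l * dot p (r s (sigma s)) + (1 - l) * dot p v &
      forall s a,
        l * dot (P s a) (r s a) + (1 - l) * dot (P s a) v <= v s + eta].
Proof.
move=> K0 Ks rB /andP[l0 l1] eta0.
have l0' : 0 <= l by exact: ltW.
have l1' : 0 <= 1 - l by rewrite subr_ge0 ltW.
pose c (u : S -> R) s a p := l * dot p (r s a) + (1 - l) * dot p u.
pose q u s a := inf [set c u s a p | p in K s a].
pose sg u s := [arg max_(a > a0) q u s a]%O.
pose T u s := q u s (sg u s).
have sgP u s a : q u s a <= T u s.
  by rewrite /T /sg; case: arg_maxP => // i _; exact.
have cB u s a p : K s a p -> (forall s, `|u s| <= B) -> `|c u s a p| <= B.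
  move=> /Ks sp uB; rewrite /c (le_trans (ler_normD _ _))// !normrM.
  rewrite (ger0_norm l0') (ger0_norm l1').
  rewrite -[leRHS](_ : l * B + (1 - l) * B = B); last by ring.
  apply: lerD; rewrite ler_wpM2l//; exact: dot_norm.
(* Monotonicity of [T] concerns every [u], not only those in the box, so this lower bound depends on
   [u]. *)
have clb u s a : has_lbound [set c u s a p | p in K s a].
  pose m := \sum_s' `|u s'|.
  have um s' : `|u s'| <= m by rewrite /m (bigD1 s')//= lerDl sumr_ge0.
  exists (- (l * B + (1 - l) * m)) => _ [p /Ks sp <-].
  rewrite opprD -!mulrN; apply: lerD; rewrite ler_wpM2l//.
    by have := dot_norm sp (rB s a); rewrite ler_norml lerNl => /andP[].
  by have := dot_norm sp um; rewrite ler_norml => /andP[].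
have Cne u s a : [set c u s a p | p in K s a] !=set0.
  by have [p Kp] := K0 s a; exists (c u s a p), p.
have qle u s a p : K s a p -> q u s a <= c u s a p.
  by move=> Kp; apply: ge_inf => //; exists p.
have Tmono u v : (forall s, u s <= v s) -> forall s, T u s <= T v s.
  move=> uv s; apply: le_trans (sgP v s (sg u s)).
  apply: lb_le_inf => // _ [p Kp <-]; apply: le_trans (qle _ _ _ _ Kp) _.
  rewrite /c lerD2l ler_wpM2l//.
  by apply: dot_le => //; exact: Ks Kp.
have Tbox u : (forall s, `|u s| <= B) -> forall s, `|T u s| <= B.
  move=> uB s; rewrite ler_norml; apply/andP; split.
    apply: lb_le_inf => // _ [p Kp <-].
    by have := cB _ _ _ _ Kp uB; rewrite ler_norml => /andP[].
  have [p Kp] := K0 s (sg u s); apply: le_trans (qle _ _ _ _ Kp) _.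
  by have := cB _ _ _ _ Kp uB; rewrite ler_norml => /andP[].
have [S0|/set0P[s0 _]] := eqVneq [set: S] set0.
  exists (fun=> 0), (fun=> a0), (fun _ _ _ => 0).
  by split=> s; have : [set: S] s by []; rewrite S0.
have B0 : 0 <= B by apply: le_trans (rB s0 a0 s0).
have [v [vB vT]] := monotone_fixpoint Tmono Tbox B0.
have /choice[P PP] : forall sa : S * A, exists p, K sa.1 sa.2 p /\
    c v sa.1 sa.2 p < q v sa.1 sa.2 + eta.
  move=> [s a] /=; have hi : has_inf [set c v s a p | p in K s a] by split.
  by have [_ [p Kp <-] h] := inf_adherent eta0 hi; exists p.
exists v, (sg v), (fun s a => P (s, a)); split=> //.
- by move=> s a; have [] := PP (s, a).
- by move=> s p Kp; rewrite -[leLHS]vT; exact: qle.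
- move=> s a; have [/= _ /ltW h] := PP (s, a); apply: le_trans h _.
  by rewrite lerD2r -[leRHS]vT.
Qed.

(** * Cluster points and recurrence *)

Lemma compact_seq (R : realType) (X : topologicalType) (K : set X)
    (x : nat -> X) (I : finType) (ev : I -> X -> R) :
  compact K -> (forall n, K (x n)) -> (forall i, continuous (ev i)) ->
  exists2 y, K y & forall e, 0 < e -> forall N, exists2 n, (N <= n)%N &
    forall i, `|ev i (x n) - ev i y| < e.
Proof.
move=> cK Kx ev_cont.
have Kx_oo : (x @ \oo) K by exists 0%N => // n _; exact: Kx.
have [y [Ky cly]] := cK _ _ Kx_oo.
exists y => // e e0 N.
have tail : (x @ \oo) [set x n | n in [set n | (N <= n)%N]].
  by exists N => // n /= Nn; exists n.
(* [I] is finite, so closeness in all coordinates is a single neighbourhood of [y]. *)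
have nby : nbhs y [set z | forall i, `|ev i z - ev i y| < e].
  apply: filter_forall => i.
  have /cvgrPdist_lt/(_ e e0) := ev_cont i y.
  by apply: filterS => z; rewrite distrC.
have [_ [[n /= Nn <-] h]] := cly _ _ tail nby.
by exists n.
Qed.

Lemma bounded_seq_cluster (R : realType) (I : finType) (v : nat -> I -> R)
    (B : R) :
  (forall n i, `|v n i| <= B) ->
  exists w, forall e, 0 < e -> forall N, exists2 n, (N <= n)%N &
    forall i, `|v n i - w i| < e.
Proof.
move=> vB.
pose K : set {ptws I -> R} := [set f | forall i, `[- B, B]%classic (f i)].
have cK : compact K.
  apply: (@tychonoff I (fun=> R) (fun=> `[- B, B]%classic)) => i.
  exact: segment_compact.
have Kv n : K (v n) by move=> i; rewrite /= in_itv /= -ler_norml.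
have evc (i : I) : continuous ((fun f => f i) : {ptws I -> R} -> R).
  exact: (@proj_continuous I (fun=> R) i).
by have [w _ hw] := compact_seq cK Kv evc; exists w.
Qed.

Lemma transitions_cluster (R : realType) (S A : finType)
    (U : set (transitions R S A)) (P : nat -> transitions R S A) :
  compact U -> (forall n, U (P n)) ->
  exists2 P0, U P0 & forall e, 0 < e -> forall N, exists2 n, (N <= n)%N &
    forall s a s', `|P n (s, a) s' - P0 (s, a) s'| < e.
Proof.
move=> cU UP.
pose ev (i : S * A * S) (Q : transitions R S A) : R := Q i.1 i.2.
have evc i : continuous (ev i).
  move=> Q; apply: (@continuous_comp _ _ _
      ((fun Q => Q i.1) : transitions R S A -> {ptws S -> R})
      ((fun f => f i.2) : {ptws S -> R} -> R)).
    exact: (@proj_continuous _ (fun=> {ptws S -> R}) i.1).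
  exact: (@proj_continuous S (fun=> R) i.2).
have [P0 UP0 h] := compact_seq cU UP evc.
exists P0 => // e e0 N; have [n Nn hn] := h e e0 N.
by exists n => // s a s'; exact: (hn (s, a, s')).
Qed.

(** Pigeonhole: if each [x] stopped occurring from [N x] on, no value would be left at the index
    [\sum_x N x]. *)
Lemma infinitely_often (F : finType) (c : nat -> F) :
  exists x, forall N, exists2 n, (N <= n)%N & c n = x.
Proof.
apply: contrapT => /forallNP h.
have /choice[N hN] : forall x, exists N, forall n, (N <= n)%N -> c n <> x.
  move=> x; have /existsNP[N hN] := h x.
  by exists N => n Nn cn; apply: hN; exists n.
pose n := (\sum_x N x)%N.
have Nn x : (N x <= n)%N by rewrite /n (bigD1 x)//= leq_addr.
exact: (hN (c n) n (Nn _) erefl).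
Qed.

(** * Gain and bias certificates *)

Section certificates.
Context (R : realType) (S A : finType) (r : S -> A -> S -> R) (B : R).
Hypothesis rB : forall s a s', `|r s a s'| <= B.
Implicit Types (K : S -> A -> set (S -> R)) (P : S -> A -> S -> R).
Implicit Types (w g h : S -> R) (sigma : S -> A).

(* [w] is a gain and [h] a bias; since nature's sets are only compact, the
   average optimality inequalities are required up to [e], with a bias that
   may blow up as [e] tends to [0]. *)
Definition guarantees sigma K w :=
  (forall s p, K s (sigma s) p -> w s <= dot p w) /\
  forall e, 0 < e -> exists h, forall s p, K s (sigma s) p ->
    w s + h s - e <= dot p (r s (sigma s)) + dot p h.

Definition caps P w :=
  (forall s a, dot (P s a) w <= w s) /\
  forall e, 0 < e -> exists h, forall s a,
    dot (P s a) (r s a) + dot (P s a) h <= w s + h s + e.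

(* At a maximum of [w' - w], pick a maximum of the difference of the biases. *)
Lemma guarantees_le_caps sigma K P w w' :
  (forall s a, simplex R S (P s a)) -> (forall s, K s (sigma s) (P s (sigma s))) ->
  guarantees sigma K w' -> caps P w -> forall s, w' s <= w s.
Proof.
move=> sP KP [gw' gh'] [cw ch] s1.
pose u s := w' s - w s.
pose s0 := [arg max_(i > s1) u i]%O.
have s0P i : u i <= u s0 by rewrite /s0; case: arg_maxP => // j _; exact.
suff u0 : u s0 <= 0 by have := le_trans (s0P s1) u0; rewrite subr_le0.
apply/ler_addgt0Pr => e e0; rewrite add0r.
have e20 : 0 < e / 2 by rewrite divr_gt0.
have [h' hh'] := gh' _ e20; have [h hh] := ch _ e20.
pose k s := h' s - h s.
pose s2 := [arg max_(i > s0 | u i == u s0) k i]%O.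
have [u2 s2P] : u s2 = u s0 /\ forall i, u i = u s0 -> k i <= k s2.
  rewrite /s2; case: arg_maxP => // j /eqP uj hj; split=> // i ui.
  by apply: hj; rewrite ui.
pose p := P s2 (sigma s2); have sp : simplex R S p by exact: sP.
have dotB f1 f2 : dot p (fun s => f1 s - f2 s) = dot p f1 - dot p f2.
  by rewrite /dot -sumrB; apply: eq_bigr => s _; rewrite mulrBr.
have pu : u s2 <= dot p u.
  by rewrite dotB lerB//; [exact/gw'/KP | exact: cw].
(* [u] is maximal at [s2] and its mean under [p] is no smaller, so [p] charges only maximizers of
   [u]; among these, [k] is maximal at [s2]. *)
have supp s : p s * (u s2 - u s) = 0.
  have nn i : 0 <= p i * (u s2 - u i).
    by rewrite mulr_ge0 ?sp.1// subr_ge0 u2.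
  have : \sum_i p i * (u s2 - u i) <= 0.
    have -> : \sum_i p i * (u s2 - u i) = dot p (fun i => (fun=> u s2) i - u i) by [].
    by rewrite dotB dot_cst// subr_le0.
  rewrite (bigD1 s)//= => le0; apply/eqP; rewrite eq_le nn andbT.
  by apply: le_trans le0; rewrite lerDl sumr_ge0.
have pk : dot p k <= k s2.
  rewrite -[leRHS](dot_cst (k s2) sp); apply: ler_sum => s _.
  have /eqP := supp s; rewrite mulf_eq0 => /orP[/eqP->|]; first by rewrite !mul0r.
  rewrite subr_eq0 => /eqP us; rewrite ler_wpM2l ?sp.1//.
  by apply: s2P; rewrite -us.
(* Subtracting the two bias inequalities cancels the rewards; [dot p k <= k s2] then leaves
   [u s2 <= e]. *)
have := hh' _ _ (KP s2); have := hh s2 (sigma s2); rewrite -/p.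
have : dot p k = dot p h' - dot p h by exact: dotB.
move: pk u2; rewrite /k /u; lra.
Qed.

(** The zero bias suffices. This bounds the values of all finite games from below, so that their
    infimum exists. *)
Lemma guarantees_bound sigma K :
  (forall s a, K s a `<=` simplex R S) -> guarantees sigma K (fun=> - B).
Proof.
move=> Ks; split=> [s p /Ks sp|e e0]; first by rewrite dot_cst.
exists (fun=> 0) => s p /Ks sp; rewrite dot_cst// !addr0.
have := dot_norm sp (rB s (sigma s)); rewrite ler_norml => /andP[+ _].
by apply: le_trans; rewrite gerDl oppr_le0 ltW.
Qed.

(* The rescaled discounted value [v / l] serves as a bias. *)
Lemma discounted_guarantees sigma K w :
  (forall s a, K s a `<=` simplex R S) ->
  (forall s p, K s (sigma s) p -> w s <= dot p w) ->
  (forall e, 0 < e -> exists l (v : S -> R), [/\ 0 < l,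
     forall s p, K s (sigma s) p ->
       v s <= l * dot p (r s (sigma s)) + (1 - l) * dot p v &
     forall s, w s - e <= v s]) ->
  guarantees sigma K w.
Proof.
move=> Ks gw H; split=> // e e0; have [l [v [l0 vP vw]]] := H e e0.
exists (fun s => l^-1 * v s) => s p Kp; rewrite dotZ.
have ln0 : l != 0 by rewrite gt_eqF.
rewrite -(ler_pM2l l0) mulrBr !mulrDr !mulrA mulfV// !mul1r.
have h1 := vP _ _ Kp; have h2 := gw _ _ Kp.
have h3 : dot p (fun s => w s - e) <= dot p v.
  by apply: dot_le => //; exact: Ks Kp.
have h4 : dot p (fun s => w s - e) = dot p w - e.
  by rewrite (dotD p w (fun=> - e)) dot_cst//; exact: Ks Kp.
have h5 : l * w s - l * e <= l * dot p v.
  by rewrite -mulrBr ler_wpM2l ?(ltW l0)//; lra.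
move: h1 h5; rewrite mulrBl mul1r; lra.
Qed.

End certificates.

(** * Games in which nature has finitely many matrices *)

Section finite_game.
Context (R : realType) (S A : finType) (a0 : A) (r : S -> A -> S -> R) (B : R).
Hypothesis rB : forall s a s', `|r s a s'| <= B.

Lemma invS2_lt e : 0 < e -> exists N, forall n, (N <= n)%N ->
  (n.+2%:R^-1 : R) < e.
Proof.
move=> e0; exists (Num.bound e^-1) => n Nn.
rewrite invf_plt ?posrE ?ltr0n//.
have := archi_boundP (ltW (ltac:(by rewrite invr_gt0) : 0 < e^-1)).
move=> /lt_trans; apply; rewrite ltr_nat; lia.
Qed.

(** The rectangular hull of [X]: rows at different state-action pairs may come from different
    matrices. *)
Definition rectangle (X : set (S -> A -> S -> R)) s a : set (S -> R) :=
  [set Q s a | Q in X].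

Lemma finite_game (X : set (S -> A -> S -> R)) : finite_set X -> X !=set0 ->
  (forall Q, X Q -> forall s a, simplex R S (Q s a)) ->
  exists sigma P w, [/\ forall s a, rectangle X s a (P s a),
    guarantees r sigma (rectangle X) w & caps r P w].
Proof.
move=> /finite_seqP[L XL] [Q0 XQ0] Xs.
have Ks s a : rectangle X s a `<=` simplex R S.
  by move=> _ [Q XQ <-]; exact: Xs.
(* [n.+2] keeps every weight strictly below 1. *)
pose l n : R := n.+2%:R^-1.
have l01 n : 0 < l n < 1 by rewrite /l invr_gt0 ltr0n invf_lt1 ?ltr0n ?ltr1n.
have l0 n : 0 < l n by case/andP: (l01 n).
have /choice[t tP] : forall n, exists t : (S -> R) * (S -> A) * (S -> A -> S -> R),
  [/\ forall s, `|t.1.1 s| <= B, forall s a, rectangle X s a (t.2 s a),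
      forall s p, rectangle X s (t.1.2 s) p ->
        t.1.1 s <= l n * dot p (r s (t.1.2 s)) + (1 - l n) * dot p t.1.1 &
      forall s a, l n * dot (t.2 s a) (r s a) + (1 - l n) * dot (t.2 s a) t.1.1
         <= t.1.1 s + l n ^+ 2].
  (* The slack [l n ^+ 2] remains small after the division by [l n] that produces a bias. *)
  move=> n; have eta0 : 0 < l n ^+ 2 by rewrite exprn_gt0.
  have [|v [sg [P ?]]] := discounted_game a0 _ Ks rB (l01 n) eta0.
    by move=> s a; exists (Q0 s a), Q0.
  by exists (v, sg, P).
have /choice[j jP] : forall nsa : nat * (S * A), exists i : 'I_(size L),
    (t nsa.1).2 nsa.2.1 nsa.2.2 = nth Q0 L i nsa.2.1 nsa.2.2.
  move=> [n [s a]] /=; have [_ /(_ s a)[Q XQ <-] _ _] := tP n.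
  have QL : Q \in L by move: XQ; rewrite XL.
  have iL : (index Q L < size L)%N by rewrite index_mem.
  by exists (Ordinal iL); rewrite /= nth_index.
(* Recording nature's rows by their indices in [L] leaves finitely many pairs of stationary
   strategies, so one pair recurs. *)
pose c n : {ffun S -> A} * {ffun S * A -> 'I_(size L)} :=
  ([ffun s => (t n).1.2 s], [ffun sa => j (n, sa)]).
have [[sg jj] io] := infinitely_often c.
have /choice[phi /all_and2[phiN phic]] : forall N, exists n,
    (N <= n)%N /\ c n = (sg, jj).
  by move=> N; have [n] := io N; exists n.
have tsg n s : (t (phi n)).1.2 s = sg s.
  by have /(congr1 fst)/= <- := phic n; rewrite ffunE.
pose P s a := nth Q0 L (jj (s, a)) s a.
have tPE n s a : (t (phi n)).2 s a = P s a.
  by rewrite (jP (_, (_, _)))/= /P; have /(congr1 snd)/= <- := phic n; rewrite ffunE.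
pose v n := (t (phi n)).1.1.
pose lam n := l (phi n).
have vB n s : `|v n s| <= B by have [+ _ _ _] := tP (phi n); exact.
have vlow n s p : rectangle X s (sg s) p ->
    v n s <= lam n * dot p (r s (sg s)) + (1 - lam n) * dot p (v n).
  by have [_ _ + _] := tP (phi n); move=> /(_ s p); rewrite tsg; exact.
have vup n s a : lam n * dot (P s a) (r s a) + (1 - lam n) * dot (P s a) (v n)
    <= v n s + lam n ^+ 2.
  by have [_ _ _ +] := tP (phi n); move=> /(_ s a); rewrite tPE; exact.
have KP s a : rectangle X s a (P s a).
  by have [_ + _ _] := tP (phi 0%N); move=> /(_ s a); rewrite tPE; exact.
have lamS e : 0 < e -> exists N, forall n, (N <= n)%N -> lam n < e.
  move=> /invS2_lt[N hN]; exists N => n Nn; apply: hN; exact: leq_trans (phiN n).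
have [w wcl] := bounded_seq_cluster vB.
have close e : 0 < e -> exists n,
    [/\ forall s, `|v n s - w s| < e, 0 < lam n & lam n < e].
  move=> e0; have [N hN] := lamS _ e0; have [n Nn hn] := wcl _ e0 N.
  by exists n; split=> //; [exact: l0 | exact: hN].
have sP s a : simplex R S (P s a) by exact: Ks (KP s a).
exists sg, P, w; split=> //.
- apply: discounted_guarantees => //.
    move=> s p Kp; have sp := Ks _ _ _ Kp; have B0 := le_trans (normr_ge0 _) (vB 0%N s).
    apply/ler_addgt0Pr => e e0.
    (* Exchanging [v n] and [w] costs [e'] on each side, and dropping the weight [lam n < e'] costs
       at most [2 * B * e']. *)
    have c0 : 0 < 2 + 2 * B by lra.
    have [n [vw ln0 ln1]] := close _ (divr_gt0 e0 c0).
    have eE : e / (2 + 2 * B) * (2 + 2 * B) = e by rewrite divfK// gt_eqF.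
    move: ln1 vw eE; set e' := e / _ => ln1 vw eE.
    have dw : dot p (v n) <= dot p w + e'.
      apply: dot_le_add => // i; have := vw i; rewrite ltr_distlC; lra.
    have := vlow n s p Kp; have := vw s; rewrite ltr_distl.
    have := dot_norm sp (rB s (sg s)); have := dot_norm sp (vB n).
    by rewrite !ler_norml => /andP[d1 _] /andP[_ d2] /andP[ws _]; nra.
  move=> e e0; have [n [vw ln0 _]] := close _ e0.
  exists (lam n), (v n); split=> // s; first exact: vlow.
  by have := vw s; rewrite ltr_distl => /andP[/ltW ? _].
- have cw s a : dot (P s a) w <= w s.
    have B0 := le_trans (normr_ge0 _) (vB 0%N s); apply/ler_addgt0Pr => e e0.
    (* As before, with one more [e'] for the slack [lam n ^+ 2 <= lam n]. *)
    have c0 : 0 < 3 + 2 * B by lra.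
    have [n [vw ln0 ln1]] := close _ (divr_gt0 e0 c0).
    have eE : e / (3 + 2 * B) * (3 + 2 * B) = e by rewrite divfK// gt_eqF.
    move: ln1 vw eE; set e' := e / _ => ln1 vw eE.
    have dw : dot (P s a) w <= dot (P s a) (v n) + e'.
      apply: dot_le_add => // i; have := vw i; rewrite ltr_distl; lra.
    have lam1 : lam n < 1 by have /andP[] := l01 (phi n).
    have := vup n s a; have := vw s; rewrite ltr_distl.
    have := dot_norm (sP s a) (rB s a); have := dot_norm (sP s a) (vB n).
    by rewrite !ler_norml => /andP[_ d1] /andP[d2 _] /andP[_ ws]; nra.
  (* After division by [lam n], one half of [e] pays for replacing [v n] by [w], the other for the
     slack, which has become [lam n]. *)
  split=> // e e0; have e20 : 0 < e / 2 by rewrite divr_gt0.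
  have [n [vw ln0 ln1]] := close _ e20.
  exists (fun s => (lam n)^-1 * v n s) => s a; rewrite dotZ.
  have dw : dot (P s a) (v n) <= dot (P s a) w + e / 2.
    apply: dot_le_add => // i; have := vw i; rewrite ltr_distl; lra.
  rewrite -(ler_pM2l ln0) !mulrDr !mulVKf ?gt_eqF//.
  have := vup n s a; have := cw s a; nra.
Qed.
End finite_game.

(* If [g, h] nearly solves the optimality inequality for the chain [p], then a
   discounted value [v] of that chain is almost above [g]: compare [v] with
   [g + l h] at a minimum of the difference. *)
Lemma discounted_ge (R : realType) (S : finType) (rho : S -> S -> R)
    (p : S -> S -> R) (g v h : S -> R) (l e H : R) :
  0 < l < 1 -> (forall s, simplex R S (p s)) ->
  (forall s, g s <= dot (p s) g) -> (forall s, `|h s| <= H) ->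
  (forall s, g s + h s - e <= dot (p s) (rho s) + dot (p s) h) ->
  (forall s, l * dot (p s) (rho s) + (1 - l) * dot (p s) v
     <= v s + l ^+ 2) ->
  forall s, g s - e - l * (2 * H + 1) <= v s.
Proof.
move=> /andP[l0 l1] sp pg hH ph pv s1.
pose d s := v s - l * h s - g s.
pose s0 := [arg min_(i < s1) d i]%O.
have s0P i : d s0 <= d i by rewrite /s0; case: arg_minP => // j _; exact.
have dE : dot (p s0) d = dot (p s0) v - l * dot (p s0) h - dot (p s0) g.
  rewrite /dot mulr_sumr -!sumrB; apply: eq_bigr => s _; rewrite /d; ring.
have : d s0 <= dot (p s0) d.
  by rewrite -[leLHS](dot_cst _ (sp s0)); exact: dot_le.
have := s0P s1; rewrite dE /d.
have := pg s0; have := ph s0; have := pv s0.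
have := dot_norm (sp s0) hH; have := hH s0; have := hH s1; rewrite !ler_norml.
set a := dot _ (rho _); set b := dot _ v; set c := dot _ h; set k := dot _ g.
move=> /andP[h1 h1'] /andP[h2 h2'] /andP[h3 h3'] E1 E2 E3 E4 E5.
(* In this combination the biases cancel up to a factor [l], so their contribution vanishes with the
   discount rate. *)
have F : l * (v s0) >= l * (g s0 + l * h s0 - e - l * c - l).
  have G1 : l * (g s0 + h s0 - e) <= l * (a + c) by rewrite ler_wpM2l ?(ltW l0).
  have G2 : (1 - l) * (v s0 - l * h s0 - g s0) <= (1 - l) * (b - l * c - k).
    by rewrite ler_wpM2l ?subr_ge0 ?(ltW l1).
  have G3 : (1 - l) * g s0 <= (1 - l) * k by rewrite ler_wpM2l ?subr_ge0 ?(ltW l1).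
  move: G1 G2 G3 E1; lra.
move: F; rewrite ler_pM2l// => F.
have : l * c <= l * H by rewrite ler_wpM2l ?(ltW l0).
have : l * h s1 >= l * - H by rewrite ler_wpM2l ?(ltW l0).
move: F E4; lra.
Qed.

(** * From finite subsets to a compact uncertainty set *)

Section compact_game.
Context (R : realType) (S A : finType) (a0 : A) (r : S -> A -> S -> R) (B : R).
Hypothesis rB : forall s a s', `|r s a s'| <= B.
Context (K : S -> A -> set (S -> R)).
Hypothesis K_simplex : forall s a, K s a `<=` simplex R S.
Context (U : set (transitions R S A)).
Hypothesis U_rect : U = [set P | forall s a, K s a (P (s, a))].
Hypothesis U_compact : compact U.
Hypothesis U_neq0 : U !=set0.

Let V : set (S -> A -> S -> R) := [set P | forall s a, K s a (P s a)].

Let good (X : set (S -> A -> S -> R)) := [/\ finite_set X, X !=set0 & X `<=` V].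

Let cert X sigma P w := [/\ forall s a, rectangle X s a (P s a),
  guarantees r sigma (rectangle X) w & caps r P w].

Let rect_sub (X X' : set (S -> A -> S -> R)) s a :
  X `<=` X' -> rectangle X s a `<=` rectangle X' s a.
Proof. by move=> XX' _ [P XP <-]; exists P => //; exact: XX'. Qed.

Let rect_K (X : set (S -> A -> S -> R)) s a : X `<=` V -> rectangle X s a `<=` K s a.
Proof. by move=> XV _ [P /XV VP <-]; exact: VP. Qed.

Let good_ex X : good X -> exists (sigma : {ffun S -> A}) P w, cert X sigma P w.
Proof.
move=> [Xfin X0 XV].
have Xs Q : X Q -> forall s a, simplex R S (Q s a).
  by move=> /XV VQ s a; exact/K_simplex/VQ.
have [sg [P [w c]]] := finite_game a0 rB Xfin X0 Xs.
exists (finfun sg), P, w.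
by rewrite (_ : (finfun sg : S -> A) = sg)//; apply/funext => s; rewrite ffunE.
Qed.

(** More matrices help nature: the cap found for [X] is still available to it in [X']. With
    [X = X'], the value of a finite game is unique. *)
Let cert_le X X' sigma sigma' P P' w w' : X `<=` X' -> good X' ->
  cert X sigma P w -> cert X' sigma' P' w' -> forall s, w' s <= w s.
Proof.
move=> XX' [_ _ X'V] [XP _ cw] [_ gw' _].
apply: (guarantees_le_caps _ _ gw' cw) => [s a|s].
  exact/K_simplex/(rect_K X'V)/(rect_sub XX')/XP.
exact/(rect_sub XX')/XP.
Qed.

Let cert_bound X sigma P w : good X -> cert X sigma P w -> forall s, - B <= w s.
Proof.
move=> [_ _ XV] [XP _ cw].
have Ks s a : rectangle X s a `<=` simplex R S.
  by move=> p /(rect_K XV)/K_simplex.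
have gB := guarantees_bound rB sigma Ks.
by apply: (guarantees_le_caps _ _ gB cw) => [s a|s]; [exact/Ks/XP | exact/XP].
Qed.

Let goodU X Y : good X -> good Y -> good (X `|` Y).
Proof.
move=> [Xf [P XP] XV] [Yf _ YV]; split; first by rewrite finite_setU.
  by exists P; left.
by move=> Q [/XV|/YV].
Qed.

Let good1 P : V P -> good [set P].
Proof. by move=> VP; split; [exact: finite_set1 | exists P | move=> _ ->]. Qed.

Let V_neq0 : exists P, V P.
Proof.
by have [P] := U_neq0; rewrite U_rect => UP; exists (fun s a => P (s, a)).
Qed.

Let good_bigcup (I : finType) (X : I -> set (S -> A -> S -> R)) :
  (forall i, good (X i)) -> exists2 Y, good Y & forall i, X i `<=` Y.
Proof.
move=> gX; have [P VP] := V_neq0.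
(* Adding [P] keeps the union nonempty even when [I] is empty. *)
exists (P |` \bigcup_i X i); last by move=> i Q XQ; right; exists i.
split.
- rewrite finite_setU; split; first exact: finite_set1.
  by apply: bigcup_finite => [|i _]; [exact: finite_finset | case: (gX i)].
- by exists P; left.
- by move=> Q [->//|[i _]]; case: (gX i) => _ _; apply.
Qed.

Let values s : set R :=
  [set x | exists X sigma P w, [/\ good X, cert X sigma P w & x = w s]].
Let g s := inf (values s).

Let values_inf s : has_inf (values s).
Proof.
split.
  have [P /good1 gP] := V_neq0; have [sg [Q [w c]]] := good_ex gP.
  by exists (w s), [set P], sg, Q, w.
by exists (- B) => _ [X [sg [P [w [gX c ->]]]]]; exact: cert_bound c _.
Qed.

Let g_le X sigma P w : good X -> cert X sigma P w -> forall s, g s <= w s.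
Proof.
move=> gX c s; apply: ge_inf; first by have [] := values_inf s.
by exists X, sigma, P, w.
Qed.

(** Each state has its own near-optimal finite set; their union serves all states at once, and
    enlarging it only lowers the values. *)
Let g_approx (e : R) : 0 < e -> exists2 X, good X &
  forall X' sigma P w, X `<=` X' -> good X' -> cert X' sigma P w ->
    forall s, w s <= g s + e.
Proof.
move=> e0.
have /choice[X hX] : forall s, exists X, good X /\
    forall X' sigma P w, X `<=` X' -> good X' -> cert X' sigma P w ->
    w s <= g s + e.
  move=> s; have [_ [X [sg [P [w [gX c ->]]]]] h] := inf_adherent e0 (values_inf s).
  exists X; split=> // X' sg' P' w' XX' gX' c'; apply: le_trans (ltW h).
  exact: cert_le XX' gX' c c' s.
have [Y gY XY] := good_bigcup (fun s => (hX s).1).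
exists Y => // X' sg P w YX' gX' c s; apply: (hX s).2 gX' c.
exact: subset_trans (XY s) YX'.
Qed.

(** There are finitely many [sigma]. If each failed above some finite set, none could be optimal for
    the union of these sets. *)
Let cofinal_sigma : exists sigma : {ffun S -> A}, forall X, good X ->
  exists X' P w, [/\ X `<=` X', good X' & cert X' sigma P w].
Proof.
apply: contrapT => /forallNP h.
have /choice[X hX] : forall sg : {ffun S -> A}, exists X, good X /\
    forall X' P w, X `<=` X' -> good X' -> ~ cert X' sg P w.
  move=> sg; have /existsNP[X /not_implyP[gX nX]] := h sg.
  exists X; split=> // X' P w XX' gX' c; apply: nX.
  by exists X', P, w.
have [Y gY XY] := good_bigcup (fun s => (hX s).1).
have [sg [P [w c]]] := good_ex gY.
exact: ((hX sg).2 Y P w (XY sg) gY c).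
Qed.

Lemma compact_game : exists (w0 : S -> R) sigma, guarantees r sigma K w0 /\
  forall e, 0 < e -> exists P w, [/\ forall s a, K s a (P s a), caps r P w &
    forall s, w s <= w0 s + e].
Proof.
have [sg sgP] := cofinal_sigma; exists g, sg; split; last first.
  move=> e /g_approx[X gX hX]; have [sg' [P [w c]]] := good_ex gX.
  exists P, w; have [c1 _ c3] := c; split=> //; last exact: hX c.
  by move=> s a; apply: rect_K (c1 s a); case: gX.
have [P1 VP1] := V_neq0.
have gK s p : K s (sg s) p -> g s <= dot p g.
  move=> Kp; apply/ler_addgt0Pr => e /g_approx[X gX hX].
  (* Splicing [p] into [P1] makes it a row of one matrix in [V], which can be added to a finite
     set. *)
  pose P2 s' a' := if (s' == s) && (a' == sg s) then p else P1 s' a'.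
  have VP2 : V P2.
    by move=> s' a'; rewrite /P2; case: ifPn => [/andP[/eqP-> /eqP->]//|_]; exact: VP1.
  have [X' [P [w [XX' gX' c]]]] := sgP _ (goodU gX (good1 VP2)).
  have wg := hX _ _ _ _ (subset_trans (@subsetUl _ _ _) XX') gX' c.
  have gw := g_le gX' c; have [_ [gw2 _] _] := c.
  apply: le_trans (gw s) _; apply: le_trans (gw2 s p _) _.
    exists P2; first by apply: XX'; right.
    by rewrite /P2 !eqxx.
  by apply: dot_le_add => //; exact: K_simplex Kp.
(* This bias depends on [P]; one that works for all rows in [K] is still to be found. *)
have bias P e : V P -> 0 < e -> exists h, forall s,
    g s + h s - e <= dot (P s (sg s)) (r s (sg s)) + dot (P s (sg s)) h.
  move=> VP e0; have [X' [Q [w [XX' gX' c]]]] := sgP _ (good1 VP).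
  have gw := g_le gX' c; have [_ [_ /(_ e e0)[h hh]] _] := c.
  exists h => s; apply: le_trans (hh s _ _); last by exists P => //; exact: XX'.
  by have := gw s; lra.
apply: discounted_guarantees => // e e0.
pose l n : R := n.+2%:R^-1.
have l01 n : 0 < l n < 1 by rewrite /l invr_gt0 ltr0n invf_lt1 ?ltr0n ?ltr1n.
have /choice[t tP] : forall n, exists t : (S -> R) * (S -> S -> R),
  [/\ forall s, K s (sg s) (t.2 s),
      forall s p, K s (sg s) p ->
        t.1 s <= l n * dot p (r s (sg s)) + (1 - l n) * dot p t.1 &
      forall s, l n * dot (t.2 s) (r s (sg s)) + (1 - l n) * dot (t.2 s) t.1
         <= t.1 s + l n ^+ 2].
  move=> n; have /andP[l0 _] := l01 n.
  have eta0 : 0 < l n ^+ 2 by rewrite exprn_gt0.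
  (* The actions are frozen at [sg]: rewards and rows ignore the action, so [a0] is a dummy and only
     nature optimizes. *)
  have [s a|s a|s a s'|v [sg' [P [_ KP v1 v2]]]] := @discounted_game R S A a0
      (fun s _ => r s (sg s)) (fun s _ => K s (sg s))
      (l n) (l n ^+ 2) B _ _ _ (l01 n) eta0.
  - by exists (P1 s (sg s)); exact: VP1.
  - exact: K_simplex.
  - exact: rB.
  by exists (v, fun s => P s a0); split=> [s|s p|s]; [exact: KP|exact: v1|exact: v2].
(* Rows of [P1] complete the reply to [sg] to an element of [U], where compactness applies. *)
pose Q n : transitions R S A :=
  fun sa => if sa.2 == sg sa.1 then (t n).2 sa.1 else P1 sa.1 sa.2.
have UQ n : U (Q n).
  rewrite U_rect => s a; rewrite /Q /=; case: eqP => [->|_]; last exact: VP1.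
  by have [+ _ _] := tP n; exact.
have [P0 UP0 cl] := transitions_cluster U_compact UQ.
have VP0 : V (fun s a => P0 (s, a)) by move: UP0; rewrite U_rect; exact.
(* Budget: [e / 4] for the bias of [P0], [e / 4] for the distance between the rows of [Q n] and
   [P0], and [e / 4] for the discount term [l n * (2 * H + 1)]. *)
have e40 : 0 < e / 4 by rewrite divr_gt0.
have [h hP] := bias _ _ VP0 e40.
pose H := \sum_s `|h s|.
have hH s : `|h s| <= H by rewrite /H (bigD1 s)//= lerDl sumr_ge0.
have [S0|/set0P[s1 _]] := eqVneq [set: S] set0.
  exists 1, g; split=> // s; have : [set: S] s by []; by rewrite S0.
have B0 : 0 <= B := le_trans (normr_ge0 _) (rB s1 a0 s1).
have H0 : 0 <= H by rewrite sumr_ge0.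
pose D := #|S|%:R * (B + H) + 1.
have D0 : 0 < D by rewrite ltr_wpDl// mulr_ge0// addr_ge0.
have H10 : 0 < 2 * H + 1 by lra.
have [N hN] := invS2_lt (divr_gt0 e40 H10).
have [n Nn close] := cl _ (divr_gt0 e40 D0) N.
have [tK t1 t2] := tP n.
have /andP[l0 l1] := l01 n.
exists (l n), (t n).1; split=> // s.
have Ksg s' : simplex R S ((t n).2 s') by exact: K_simplex (tK s').
have near s' : g s' + h s' - e / 2 <=
    dot ((t n).2 s') (r s' (sg s')) + dot ((t n).2 s') h.
  have rh s'' : `|r s' (sg s') s'' + h s''| <= B + H.
    by apply: le_trans (ler_normD _ _) _; exact: lerD.
  have cls s'' : `|(t n).2 s' s'' - P0 (s', sg s') s''| <= e / 4 / D.
    by apply/ltW; have := close s' (sg s') s''; rewrite /Q /= eqxx.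
  have := dot_near cls rh; rewrite !dotD ler_norml => /andP[+ _].
  have -> : #|S|%:R * (e / 4 / D * (B + H)) = e / 4 / D * (D - 1).
    by rewrite /D; ring.
  have e4D : 0 < e / 4 / D by rewrite divr_gt0.
  rewrite mulrBr divfK ?gt_eqF//.
  by have := hP s'; lra.
have := discounted_ge (l01 n) Ksg (fun s' => gK s' _ (tK s')) hH near t2 s.
have : l n * (2 * H + 1) <= e / 4.
  by rewrite -ler_pdivlMr; [apply/ltW; exact: hN | lra].
lra.
Qed.
End compact_game.

(** * Integrals of upper limits *)

Section limsup_integral.
Context (R : realType) d (T : measurableType d) (mu : probability T R).
Context (a : nat -> T -> R) (B : R).
Hypothesis a_meas : forall n, measurable_fun setT (a n).
Hypothesis aB : forall n w, `|a n w| <= B.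

Lemma bounded_integrable (f : T -> R) (C : R) : measurable_fun setT f ->
  (forall w, `|f w| <= C) -> mu.-integrable setT (EFin \o f).
Proof.
move=> mf fC; apply: measurable_bounded_integrable => //.
  by rewrite [X in (X < _)%E]probability_setT ltry.
exists C; split; first exact: num_real.
by move=> x Cx w _ /=; apply: le_trans (fC w) (ltW Cx).
Qed.

Let ea w n : \bar R := (a n w)%:E.

Let es n : T -> \bar R := fun w => esups (ea w) n.
Let ls : T -> \bar R := fun w => limn_esup (ea w).

Let esups_meas n : measurable_fun setT (es n).
Proof.
by apply: measurable_fun_esups => k; exact/measurable_EFinP.
Qed.

Let limsup_meas : measurable_fun setT ls.
Proof.
apply: measurable_fun_limn_esup => k; exact/measurable_EFinP.
Qed.

Let le_esups w n k : (n <= k)%N -> (ea w k <= esups (ea w) n)%E.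
Proof. by move=> nk; apply: ereal_sup_ubound; exists k. Qed.

Let esups_le w n (x : \bar R) : (forall k, (n <= k)%N -> (ea w k <= x)%E) ->
  (esups (ea w) n <= x)%E.
Proof. by move=> h; apply: ge_ereal_sup => _ [k /= nk <-]; exact: h. Qed.

Let esups_bound w n : (`|esups (ea w) n| <= B%:E)%E.
Proof.
have b k : (- B%:E <= ea w k <= B%:E)%E.
  by rewrite -EFinN /ea !lee_fin -ler_norml.
have lo : (- B%:E <= esups (ea w) n)%E.
  by apply: le_trans (le_esups w (leqnn n)); have /andP[] := b n.
have hi : (esups (ea w) n <= B%:E)%E.
  by apply: esups_le => k _; have /andP[] := b k.
move: lo hi; case: (esups _ _) => [x| |]//.
by rewrite -EFinN abse_EFin !lee_fin ler_norml => -> ->.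
Qed.

Let limsup_le_esups w n : (limn_esup (ea w) <= esups (ea w) n)%E.
Proof.
rewrite limn_esup_lim; apply: lime_le; first exact: is_cvg_esups.
by exists n => // m /= nm; exact: nonincreasing_esups.
Qed.

Let cst_integrable (c : R) : mu.-integrable setT (fun=> c%:E).
Proof.
apply: (bounded_integrable (f := fun=> c) (C := `|c|)) => //; exact: measurable_cst.
Qed.

(** The tail suprema converge to the upper limit and stay between [- B] and [B]. *)
Let dominated :
  mu.-integrable setT (fun w => limn_esup (ea w)) /\
  (\int[mu]_w esups (ea w) n)%E @[n --> \oo] -->
    (\int[mu]_w limn_esup (ea w))%E.
Proof.
have [|||? _ ?] := @dominated_convergence _ _ _ mu setT measurableT
  es ls (fun=> B%:E)
  esups_meas limsup_meas; last by split.
- by apply/nearW => w _; rewrite /ls limn_esup_lim; exact: is_cvg_esups.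
- exact: cst_integrable.
- by apply/nearW => w n _; exact: esups_bound.
Qed.

(** Each [a n] lies below its tail supremum, and the integrals of these suprema converge to that of
    the upper limit. *)
Lemma limsup_integral_ge (c D : R) :
  (forall n, c - D / n.+1%:R <= \int[mu]_w a n w) ->
  (c%:E <= \int[mu]_w limn_esup (fun n => (a n w)%:E))%E.
Proof.
move=> ha; apply/lee_subgt0Pr => e e0.
apply: (cvge_ge _ dominated.2).
have [N hN] : exists N, forall n, (N <= n)%N -> D / n.+1%:R <= e.
  exists (Num.bound (`|D| / e)) => n Nn.
  rewrite ler_pdivrMr// -ler_pdivrMl//.
  apply: le_trans (_ : `|D| / e <= _).
    by rewrite mulrC ler_pM2r ?invr_gt0// ler_norm.
  have /ltW h := archi_boundP (divr_ge0 (normr_ge0 D) (ltW e0)).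
  by apply: le_trans h _; rewrite ler_nat; exact: leq_trans Nn _.
exists N => // n /= Nn; rewrite -EFinB.
apply: (@le_trans _ _ (\int[mu]_w (a n w))%:E).
  by rewrite lee_fin; apply: le_trans (ha n); rewrite lerD2l lerN2; exact: hN.
have ia := bounded_integrable (a_meas n) (aB n).
rewrite /Rintegral fineK; last exact: integrable_fin_num.
have ies : mu.-integrable setT (es n).
  apply: (le_integrable measurableT (esups_meas n) _ (cst_integrable B)) => w _.
  by apply: le_trans (esups_bound w n) _; rewrite lee_fin ler_norm.
apply: (le_integral measurableT ia ies) => w _; exact: le_esups.
Qed.

(** A pathwise bound with a random error made of nonnegative terms of total expectation at most [e].
    Completing the partial sums to the whole series makes the error independent of [n]. *)
Lemma limsup_integral_le (Y : T -> R) (f : nat -> T -> R) (N : nat)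
    (C c D e : R) :
  measurable_fun setT Y -> (forall w, `|Y w| <= C) ->
  (forall n, measurable_fun setT (f n)) -> (forall n w, 0 <= f n w) ->
  (forall n, mu.-integrable setT (EFin \o f n)) ->
  (forall n, \sum_(t < n) \int[mu]_w f t w <= e) -> 0 <= D ->
  (forall w n, (N <= n)%N ->
     exists m, a n w <= Y w + \sum_(t < m) f t w + c + D / n.+1%:R) ->
  (\int[mu]_w limn_esup (fun n => (a n w)%:E) <=
     (\int[mu]_w Y w + e + c)%:E)%E.
Proof.
move=> mY YC mf f0 fi fe D0 ha; apply/lee_addgt0Pr => e1 e10.
have [M NM hM] : exists2 M, (N <= M)%N & D / M.+1%:R <= e1.
  exists (N + Num.bound (D / e1))%N; first exact: leq_addr.
  rewrite ler_pdivrMr// -ler_pdivrMl// mulrC.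
  have /ltW h := archi_boundP (divr_ge0 D0 (ltW e10)); apply: le_trans h _.
  by rewrite ler_nat; apply: leqW; exact: leq_addl.
(* The series may diverge on some paths, hence the extended reals; its integral, taken term by term,
   is at most [e]. *)
pose F : T -> \bar R := fun w => (\sum_(0 <= t <oo) (f t w)%:E)%E.
have ef0 n w : (0 <= (f n w)%:E)%E by rewrite lee_fin.
have mef n : measurable_fun setT (fun w => (f n w)%:E) by exact/measurable_EFinP.
have F0 w : (0 <= F w)%E by exact: nneseries_ge0.
have mF : measurable_fun setT F by exact: ge0_emeasurable_sum.
have intF : (\int[mu]_w F w <= e%:E)%E.
  rewrite integral_nneseries//; apply: lime_le.
    by apply: is_cvg_nneseries => n _ _; exact: integral_ge0.
  apply: nearW => n; rewrite big_mkord.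
  rewrite (eq_bigr (fun t : 'I_n => (\int[mu]_w f t w)%:E)).
    by rewrite sumEFin lee_fin; exact: fe.
  by move=> t _; rewrite /Rintegral fineK//; exact: integrable_fin_num (fi t).
have iF : mu.-integrable setT F.
  apply/integrableP; split=> //; apply: le_lt_trans (ltry e).
  by under eq_integral do rewrite gee0_abs//.
pose c' := c + e1.
have iY := bounded_integrable mY YC.
have iG : mu.-integrable setT (fun w => (Y w)%:E + F w + c'%:E)%E.
  by apply: integrableD => //; apply: integrableD.
apply: (@le_trans _ _ (\int[mu]_w ((Y w)%:E + F w + c'%:E))%E).
  apply: le_integral => //; first exact: dominated.1.
  move=> w _; apply: le_trans (limsup_le_esups w M) _.
  apply: esups_le => n Mn; have Nn := leq_trans NM Mn.
  have [m hm] := ha w n Nn; rewrite /ea.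
  apply: (@le_trans _ _ ((Y w)%:E + (\sum_(t < m) f t w)%:E + c'%:E)%E).
    rewrite -!EFinD lee_fin; apply: le_trans hm _; rewrite -addrA lerD2l lerD2l.
    apply: le_trans hM; rewrite ler_wpM2l// lef_pV2 ?posrE// ler_nat.
    by rewrite ltnS.
  rewrite leeD2r// leeD2l// -sumEFin -(big_mkord xpredT (fun t => (f t w)%:E)).
  exact: nneseries_lim_ge.
rewrite integralD//; last exact: integrableD.
rewrite integralD// integral_cst//.
rewrite [X in (_ * X)%E](_ : _ = 1%E) ?mule1; last exact: probability_setT.
have -> : (\int[mu]_w (Y w)%:E)%E = (\int[mu]_w Y w)%:E.
  by rewrite /Rintegral fineK//; exact: integrable_fin_num iY.
apply: le_trans (leeD2r _ (leeD2l _ intF)) _.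
by rewrite -!EFinD lee_fin /c' addrA.
Qed.
End limsup_integral.

(** * Expectations of functions of finitely many periods *)

Section local_functions.
Context (R : realType) (M : rmdp R).
Let I : finType := (state M * action M)%type.
Let x0 : I := sa_point M.
Implicit Types (f g : traj M -> R) (w v : traj M).

Definition local n f := forall w v, (forall i, (i < n)%N -> w i = v i) -> f w = f v.

Definition cylinder w n : set (path_space M) :=
  [set v : traj M | forall i, (i < n)%N -> v i = w i].

Lemma localW n m f : (n <= m)%N -> local n f -> local m f.
Proof. by move=> nm lf w v wv; apply: lf => i /leq_trans/(_ nm)/wv. Qed.

Lemma localD n f g : local n f -> local n g -> local n (fun w => f w + g w).
Proof. by move=> lf lg w v wv; rewrite (lf w v)// (lg w v). Qed.

Lemma localB n f g : local n f -> local n g -> local n (fun w => f w - g w).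
Proof. by move=> lf lg w v wv; rewrite (lf w v)// (lg w v). Qed.

Lemma localM n f g : local n f -> local n g -> local n (fun w => f w * g w).
Proof. by move=> lf lg w v wv; rewrite (lf w v)// (lg w v). Qed.

Lemma local_sum (J : Type) (r : seq J) (P : pred J) n (F : J -> traj M -> R) :
  (forall j, P j -> local n (F j)) -> local n (fun w => \sum_(j <- r | P j) F j w).
Proof. by move=> lF w v wv; apply: eq_bigr => j /lF; apply. Qed.

Let ext n (s : n.-tuple I) : traj M := nth x0 s.

Let trunc n w : n.-tuple I := [tuple w i | i < n].

Let ext_trunc n w i : (i < n)%N -> ext (trunc n w) i = w i.
Proof. by move=> ni; rewrite /ext (nth_mktuple _ x0 (Ordinal ni)). Qed.

(** As states and actions are finite, a function of [n] periods is a finite combination of cylinder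
    indicators; measurability and [expect_last] reduce to these. *)
Lemma local_decomposition n f : local n f -> forall w,
  f w = \sum_(s : n.-tuple I) f (ext s) * \1_(cylinder (ext s) n) w.
Proof.
move=> lf w; rewrite (bigD1 (trunc n w))//= big1 ?addr0.
  rewrite indicE mem_set ?mulr1; first by apply: lf => i ni; rewrite ext_trunc.
  by move=> i ni; rewrite ext_trunc.
move=> s sw; rewrite indicE memNset ?mulr0// => h.
move/eqP: sw; apply; apply: eq_from_tnth => i.
by rewrite tnth_mktuple h// /ext -tnth_nth.
Qed.

Lemma cylinder_measurable w n : measurable (cylinder w n).
Proof.
rewrite (_ : cylinder w n = \bigcap_(i in `I_n) [set v : path_space M | [set w i] (v i)]).
  apply: fin_bigcap_measurable => // i _.
  by apply: sub_sigma_algebra; exists i, [set w i].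
by apply/seteqP; split.
Qed.

Lemma local_measurable n f : local n f ->
  measurable_fun setT (f : path_space M -> R).
Proof.
move=> lf; rewrite (funext (local_decomposition lf)).
apply: measurable_sum => s; apply: measurable_funM; first exact: measurable_cst.
apply: measurable_indic; exact: cylinder_measurable.
Qed.

Lemma local_bounded n f : local n f -> exists C, forall w, `|f w| <= C.
Proof.
move=> lf; exists (\sum_(s : n.-tuple I) `|f (ext s)|) => w.
rewrite (bigD1 (trunc n w))//= [leLHS](_ : _ = `|f (ext (trunc n w))|).
  by rewrite lerDl sumr_ge0.
by congr `|_|; apply: lf => i ni; rewrite ext_trunc.
Qed.

Context (mu : probability (path_space M) R).

Lemma local_integrable n f : local n f -> mu.-integrable setT (EFin \o f).
Proof.
move=> lf; have [C fC] := local_bounded lf.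
exact: bounded_integrable (local_measurable lf) fC.
Qed.

Definition expect f : R := \int[mu]_w f w.

Lemma expectD n f g : local n f -> local n g ->
  expect (fun w => f w + g w) = expect f + expect g.
Proof.
by move=> /local_integrable fi /local_integrable gi; exact: RintegralD.
Qed.

Lemma expectZ n (c : R) f : local n f -> expect (fun w => c * f w) = c * expect f.
Proof. by move=> /local_integrable fi; exact: RintegralZl. Qed.

Lemma expectB n f g : local n f -> local n g ->
  expect (fun w => f w - g w) = expect f - expect g.
Proof.
by move=> /local_integrable fi /local_integrable gi; exact: RintegralB.
Qed.

Lemma expect_cst (c : R) : expect (fun=> c) = c.
Proof.
rewrite /expect Rintegral_cst//.
rewrite [X in fine X](_ : _ = 1%E) ?mulr1//; exact: probability_setT.
Qed.

Lemma expect_le n f g : local n f -> local n g -> (forall w, f w <= g w) ->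
  expect f <= expect g.
Proof.
move=> /local_integrable fi /local_integrable gi fg.
by apply: le_Rintegral.
Qed.

Lemma expect_norm n f (C : R) : local n f -> (forall w, `|f w| <= C) ->
  `|expect f| <= C.
Proof.
move=> lf fC; rewrite ler_norml; apply/andP; split.
  rewrite -[leLHS]expect_cst; apply: (expect_le (n := n)) => // w.
  by have := fC w; rewrite ler_norml => /andP[].
rewrite -[leRHS]expect_cst; apply: (expect_le (n := n)) => // w.
by have := fC w; rewrite ler_norml => /andP[].
Qed.

Lemma expect_sum n (J : Type) (r : seq J) (F : J -> traj M -> R) :
  (forall j, local n (F j)) ->
  expect (fun w => \sum_(j <- r) F j w) = \sum_(j <- r) expect (F j).
Proof.
move=> lF; elim: r => [|j r IH].
  by rewrite big_nil -[RHS](expect_cst 0); congr expect; apply/funext => w;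
    rewrite big_nil.
rewrite big_cons -IH -(expectD (lF j)); last by apply: local_sum => i _; exact: lF.
by congr expect; apply/funext => w; rewrite big_cons.
Qed.

Lemma expect_cylinder w n : expect \1_(cylinder w n) = fine (mu (cylinder w n)).
Proof.
rewrite /expect /Rintegral integral_indic ?setIT//; exact: cylinder_measurable.
Qed.

Context (k : traj M -> nat -> I -> R).
Hypothesis k_local : forall n x, local n (fun w => k w n x).
Hypothesis mu_cylinder : forall w n,
  mu (cylinder w n) = (\prod_(t < n) k w t (w t))%:E.

Definition update w n (x : I) : traj M := fun t => if t == n then x else w t.

Lemma update_lt w n x i : (i < n)%N -> update w n x i = w i.
Proof. by move=> ni; rewrite /update ltn_eqF. Qed.

Lemma update_eq w n x : update w n x n = x.
Proof. by rewrite /update eqxx. Qed.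

(** For [f] local in [n.+1] periods, this is the conditional expectation of [f] given the first [n]
    of them. *)
Let bell n f w := \sum_x k w n x * f (update w n x).

Let cylinder_local w n m : (n <= m)%N -> local m (\1_(cylinder w n) : traj M -> R).
Proof.
move=> nm u v uv; rewrite !indicE; congr (_%:R); congr (nat_of_bool _).
by apply/idP/idP => /set_mem h; apply/mem_set => i ni; rewrite -h// uv// (leq_trans ni).
Qed.

Let bell_cylinder w n v : bell n \1_(cylinder w n.+1) v =
  k w n (w n) * \1_(cylinder w n) v.
Proof.
rewrite /bell (bigD1 (w n))//= big1 ?addr0.
  have [vw|vw] := pselect (cylinder w n v).
    rewrite !indicE !mem_set// ?mulr1; first by apply: k_local => i /vw.
    move=> i; rewrite ltnS leq_eqVlt => /orP[/eqP->|ni].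
      by rewrite update_eq.
    by rewrite update_lt// vw.
  rewrite !indicE !memNset// ?mulr0// => h; apply: vw => i ni.
  by rewrite -h ?update_lt// ltnW.
move=> x xw; rewrite indicE memNset ?mulr0// => /(_ n (ltnSn n)).
by rewrite update_eq; exact/eqP.
Qed.

(** The tower property for the last period: on cylinders it is the product formula [mu_cylinder],
    and linearity does the rest. *)
Lemma expect_last n f : local n.+1 f -> expect f =
  expect (fun w => \sum_x k w n x * f (update w n x)).
Proof.
move=> lf; rewrite -[RHS]/(expect (bell n f)).
have bE v : bell n f v = \sum_(s : n.+1.-tuple I) f (ext s) *
    (k (ext s) n (ext s n) * \1_(cylinder (ext s) n) v).
  under eq_bigr do rewrite -bell_cylinder.
  rewrite /bell; under [RHS]eq_bigr do rewrite mulr_sumr.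
  rewrite exchange_big /=; apply: eq_bigr => x _.
  rewrite (local_decomposition lf) mulr_sumr; apply: eq_bigr => s _; ring.
rewrite (funext bE) [in LHS](funext (local_decomposition lf)).
have lc (s : n.+1.-tuple I) := cylinder_local (ext s) (leqnn n.+1).
have lc' (s : n.+1.-tuple I) := cylinder_local (ext s) (leqnSn n).
rewrite (@expect_sum n.+1); last by move=> s; apply: localM.
rewrite (@expect_sum n.+1); last by move=> s; do 2![apply: localM => //].
apply: eq_bigr => s _; rewrite (expectZ _ (lc s)) (expectZ (n := n.+1)); last first.
  exact: localM.
rewrite (expectZ _ (lc' s)) !expect_cylinder !mu_cylinder big_ord_recr.
rewrite [RHS]mulrCA [in RHS]mulrC.
by rewrite mulrA.
Qed.

End local_functions.

(** * One-step conditioning under the law of the process *)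

Section law_expectation.
Context (R : realType) (M : rmdp R) (pi : policy M) (P : adversary M).
Let I : finType := (state M * action M)%type.
Let mu := law pi P.

Let kernel (w : traj M) (n : nat) (x : I) : R :=
  (if n is m.+1 then val (transition_at P w m) (w m) x.1 else init M x.1) *
  pi (mkseq w n, x.1) x.2.

Definition transition_row (w : traj M) n : state M -> R :=
  val (transition_at P w n) (w n).

Lemma transition_row_simplex w n : simplex R (state M) (transition_row w n).
Proof.
by have /set_mem/(uset_simplex (r := M)) := valP (transition_at P w n); apply.
Qed.

Let past_local w v n : (forall i, (i < n)%N -> w i = v i) ->
  past P w n = past P v n.
Proof.
elim: n => //= n IH wv; rewrite IH ?wv// => i ni.
by apply: wv; apply: ltnW.
Qed.

Lemma transition_row_local n s : local n.+1 (fun w => transition_row w n s).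
Proof.
move=> w v wv; rewrite /transition_row /transition_at wv//.
by rewrite (@past_local w v)// => i ni; apply: wv; apply: ltnW.
Qed.

Let mkseq_local (w v : traj M) n : (forall i, (i < n)%N -> w i = v i) ->
  mkseq w n = mkseq v n.
Proof.
move=> wv; apply/eq_in_map => i; rewrite mem_iota add0n => /andP[_]; exact: wv.
Qed.

Let kernel_local n x : local n (fun w => kernel w n x).
Proof.
move=> w v wv; rewrite /kernel (mkseq_local wv); congr (_ * _).
by case: n wv => // n /transition_row_local; apply.
Qed.

Let law_cylinder w n : mu (cylinder w n) = (\prod_(t < n) kernel w t (w t))%:E.
Proof.
case: n => [|t].
  rewrite big_ord0 (_ : cylinder w 0 = setT) ?probability_setT//.
  by apply/seteqP; split.
rewrite (lawP pi P w t) /path_prob; congr (_%:E); elim: t => [|t IH].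
  by rewrite !big_ord_recr !big_ord0 /= mul1r mulr1 mul1r.
rewrite [RHS]big_ord_recr -IH /= [X in _ * X * _ = _]big_ord_recr /=.
rewrite [X in _ * X = _]big_ord_recr /= /kernel /action_at /=; ring.
Qed.

Let E := expect mu.

Lemma expect_init (phi : state M -> R) :
  E (fun w => phi (w 0%N).1) = dot (init M) phi.
Proof.
rewrite /E (expect_last kernel_local law_cylinder (n := 0)); last first.
  by move=> w v wv; rewrite wv.
rewrite -[RHS](expect_cst mu); congr expect; apply/funext => w.
under eq_bigr do rewrite update_eq.
rewrite -(pair_bigA _ (fun s a => init M s * pi (mkseq w 0, s) a * phi s)) /=.
apply: eq_bigr => s _; rewrite -mulr_suml -mulr_sumr (policy_simplex pi _).2.
by rewrite mulr1.
Qed.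

(** Given the past up to the action at period [n], the next state has law [transition_row w n]; the
    next action integrates out because [phi] ignores it. *)
Lemma expect_next n (phi : traj M -> state M -> R) :
  (forall s, local n.+1 (phi^~ s)) ->
  E (fun w => phi w (w n.+1).1) = E (fun w => dot (transition_row w n) (phi w)).
Proof.
move=> lphi.
rewrite /E (expect_last kernel_local law_cylinder (n := n.+1)); last first.
  move=> w v wv; rewrite wv//; apply: lphi => i ni; exact/wv/ltnW.
congr expect; apply/funext => w.
rewrite (eq_bigr (fun x => kernel w n.+1 x * phi w x.1)); last first.
  move=> x _; rewrite update_eq; congr (_ * _).
  by apply: lphi => i ni; rewrite update_lt.
rewrite -(pair_bigA _ (fun s a => transition_row w n s *
  pi (mkseq w n.+1, s) a * phi w s)) /=.
apply: eq_bigr => s _; rewrite -mulr_suml -mulr_sumr (policy_simplex pi _).2.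
by rewrite mulr1.
Qed.

(** Actions of probability zero do not count. Under a stationary policy, inequalities are thus
    needed only for the prescribed action. *)
Lemma expect_le_policy n f g : local n.+1 f -> local n.+1 g ->
  (forall w, pi (mkseq w n, (w n).1) (w n).2 != 0 -> f w <= g w) -> E f <= E g.
Proof.
move=> lf lg fg.
rewrite /E (expect_last kernel_local law_cylinder lf).
rewrite (expect_last kernel_local law_cylinder lg).
have lu h : local n.+1 h -> local n (fun w => \sum_x kernel w n x * h (update w n x)).
  move=> lh; apply: local_sum => x _; apply: localM; first exact: kernel_local.
  move=> w v wv; apply: lh => i; rewrite ltnS leq_eqVlt => /orP[/eqP->|ni].
    by rewrite !update_eq.
  by rewrite !update_lt// wv.
apply: (@expect_le _ _ _ n) => [||w]; [exact: lu | exact: lu |].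
apply: ler_sum => x _; have [z|nz] := eqVneq (pi (mkseq w n, x.1) x.2) 0.
  by rewrite /kernel z mulr0 !mul0r.
rewrite ler_wpM2l//.
  rewrite mulr_ge0 ?(policy_simplex pi _).1//.
  case: (n) => [|m]; first exact: (init_simplex M).1.
  exact: (transition_row_simplex w m).1.
apply: fg; rewrite update_eq (@mkseq_local _ w)// => i ni; exact: update_lt.
Qed.

End law_expectation.

(** * Bounds on the average return *)

Section average_return.
Context (R : realType) (M : rmdp R).
Implicit Types (w : traj M) (g h : state M -> R).

Let B : R := \sum_(x : state M * action M * state M)
  `|reward M x.1.1 x.1.2 x.2|.

Lemma reward_bound s a s' : `|reward M s a s'| <= B.
Proof.
by rewrite /B (bigD1 (s, a, s'))//= lerDl sumr_ge0.
Qed.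

Lemma finite_bound (T : finType) (f : T -> R) :
  exists2 C, 0 <= C & forall x, `|f x| <= C.
Proof.
exists (\sum_x `|f x|) => [|x]; first exact: sumr_ge0.
by rewrite (bigD1 x)//= lerDl sumr_ge0.
Qed.

Let rew w t : R := reward M (w t).1 (w t).2 (w t.+1).1.

Let rew_local t : local t.+2 (rew^~ t).
Proof. by move=> w v wv; rewrite /rew !wv. Qed.

Definition average w n : R := (\sum_(t < n.+1) rew w t) / n.+1%:R.

Let average_local n : local n.+2 (average^~ n).
Proof.
apply: localM => //; apply: local_sum => t _.
by apply: (localW _ (@rew_local t)); rewrite ltnS.
Qed.

Let average_bound n w : `|average w n| <= B.
Proof.
rewrite /average normrM normfV [X in _ / X]ger0_norm// ler_pdivrMr//.
apply: le_trans (ler_norm_sum _ _ _) _.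
rewrite [leRHS](_ : _ = \sum_(t < n.+1) B); last first.
  by rewrite sumr_const card_ord mulr_natr.
by apply: ler_sum => t _; exact: reward_bound.
Qed.

Lemma state_local n (phi : state M -> R) : local n.+1 (fun w => phi (w n).1).
Proof. by move=> w v wv; rewrite wv. Qed.

Lemma stationary_policy_simplex (sigma : state M -> action M)
    (h : seq (state M * action M) * state M) :
  simplex R (action M) (fun a => (a == sigma h.2)%:R).
Proof.
split=> [a|]; first exact: ler0n.
by rewrite (bigD1 (sigma h.2))//= eqxx big1 ?addr0// => a /negPf->.
Qed.

Definition stationary_policy sigma : policy M :=
  Policy (stationary_policy_simplex sigma).

(** The expected gain never decreases, so it stays above its initial mean. Summing the bias
    inequality telescopes [h], at a total cost of at most [2 * H], which averaging removes. *)
Lemma Ravg_ge (sigma : state M -> action M)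
    (K : state M -> action M -> set (state M -> R)) g (P : adversary M) :
  (forall (Q : nature M) s a, K s a (val Q (s, a))) ->
  guarantees (reward M) sigma K g ->
  ((dot (init M) g)%:E <= Ravg (stationary_policy sigma) P)%E.
Proof.
move=> QK [gg gh]; apply/lee_subgt0Pr => e e0; rewrite -EFinB.
have [h hh] := gh e e0; have [H H0 hH] := finite_bound h.
pose pi := stationary_policy sigma; pose E := expect (law pi P).
have row_in w n : pi (mkseq w n, (w n).1) (w n).2 != 0 ->
    (w n).2 = sigma (w n).1 /\ K (w n).1 (sigma (w n).1) (transition_row P w n).
  have [wE _|/negPf ne] := eqVneq (w n).2 (sigma (w n).1); last first.
    by rewrite /= ne eqxx.
  split=> //; rewrite -wE; have := QK (transition_at P w n) (w n).1 (w n).2.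
  by rewrite -surjective_pairing.
have lrow n (phi : traj M -> state M -> R) : (forall s, local n.+1 (phi^~ s)) ->
    local n.+1 (fun w => dot (transition_row P w n) (phi w)).
  move=> lphi; apply: local_sum => s _; apply: localM => //.
  exact: transition_row_local.
have gS n : E (fun w => g (w n).1) <= E (fun w => g (w n.+1).1).
  rewrite /E (@expect_next _ _ _ _ n (fun _ s => g s))//.
  apply: expect_le_policy => [||w /row_in[_ Kw]]; first exact: state_local.
    exact: lrow.
  exact: gg.
have g0 n : dot (init M) g <= E (fun w => g (w n).1).
  elim: n => [|n IH]; first by rewrite /E expect_init.
  exact: le_trans (gS n).
have rS n : E (fun w => g (w n).1) + E (fun w => h (w n).1) - e <=
    E (rew^~ n) + E (fun w => h (w n.+1).1).
  rewrite /E -(expectD _ (@rew_local n)); last exact: state_local.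
  rewrite (@expect_next _ _ _ _ n (fun w s => reward M (w n).1 (w n).2 s + h s)); last first.
    by move=> s w v wv; rewrite wv.
  rewrite -(expectD (law pi P) (@state_local n g) (@state_local n h)).
  rewrite -[X in _ - X](expect_cst (law pi P)) -(expectB (law pi P) (n := n.+1))//; last first.
    by apply: localD; exact: state_local.
  apply: expect_le_policy.
  - by apply: localB => //; apply: localD; exact: state_local.
  - by apply: lrow => s w v wv; rewrite wv.
  - by move=> w /row_in[wE Kw]; rewrite dotD wE; exact: hh.
have sumS n : n%:R * (dot (init M) g - e) + E (fun w => h (w 0%N).1) <=
    \sum_(t < n) E (rew^~ t) + E (fun w => h (w n).1).
  elim: n => [|n IH]; first by rewrite big_ord0 mul0r.
  rewrite big_ord_recr -natr1 mulrDl /=.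
  have := rS n; have := g0 n; lra.
have Eh n : `|E (fun w => h (w n).1)| <= H.
  by apply: (expect_norm (law pi P) (n := n.+1)) => [|w]; [exact: state_local | exact: hH].
apply: (@limsup_integral_ge _ _ _ (law pi P) (fun n w => average w n) B _ _ _ (2 * H)) => [n|n w|n].
- exact: local_measurable (@average_local n).
- exact: average_bound.
rewrite -[leRHS]/(E (average^~ n)).
have -> : E (average^~ n) = n.+1%:R^-1 * \sum_(t < n.+1) E (rew^~ t).
  rewrite /E -(expect_sum (law pi P) (n := n.+2)); last first.
    by move=> t; apply: (localW _ (@rew_local t)); rewrite ltnS.
  rewrite -(expectZ (law pi P) (n := n.+2)); last first.
    by apply: local_sum => t _; apply: (localW _ (@rew_local t)); rewrite ltnS.
  by congr expect; apply/funext => w; rewrite mulrC.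
rewrite -(ler_pM2l (_ : 0 < n.+1%:R))// mulVKf// mulrBr [X in _ - X]mulrC divfK//.
have := Eh 0%N; have := Eh n.+1; rewrite !ler_norml; have := sumS n.+1; lra.
Qed.

Lemma summable_tail (b : nat -> R) (C e : R) : (forall n, 0 <= b n) ->
  (forall n, \sum_(t < n) b t <= C) -> 0 < e ->
  exists N, forall m, \sum_(i < m) b (N + i)%N <= e.
Proof.
move=> b0 bC e0; pose X := range (fun n => \sum_(t < n) b t).
have hX : has_sup X.
  split; first by exists (\sum_(t < 0) b t), 0%N.
  by exists C => _ [n _ <-].
have [_ [N _ <-] hN] := sup_adherent e0 hX.
exists N => m; have : \sum_(t < N + m) b t <= sup X.
  by apply: ub_le_sup; [case: hX | exists (N + m)%N].
by rewrite big_split_ord /=; move: hN; lra.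
Qed.

(** [expR x] is the inverse of [expR (- x) >= 1 - x], and [(1 + x + 2 * x ^+ 2) * (1 - x) >= 1] as
    long as [x <= 1 / 2]. *)
Lemma expR_quadratic (x : R) : `|x| <= 2^-1 -> expR x <= 1 + x + 2 * x ^+ 2.
Proof.
rewrite ler_norml => /andP[x1 x2].
have h := expR_ge1Dx (- x).
have y0 : 0 < 1 - x by lra.
have -> : expR x = (expR (- x))^-1 by rewrite expRN invrK.
apply: (@le_trans _ _ (1 - x)^-1); first by rewrite lef_pV2 ?posrE ?expR_gt0.
rewrite -[leLHS]mul1r ler_pdivrMr//; nra.
Qed.

(** * Pathwise upper bound against a stationary adversary *)

Section upper_bound.
Context (pi : policy M) (Q : nature M) (g : state M -> R).
Let P : adversary M := stationary Q.
Let E := expect (law pi P).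
Hypothesis g_caps : caps (reward M) (fun s a => val Q (s, a)) g.

Let rowE w n : transition_row P w n = val Q ((w n).1, (w n).2).
Proof. by rewrite -surjective_pairing. Qed.

Let row_le w n : dot (transition_row P w n) g <= g (w n).1.
Proof. by rewrite rowE; exact: g_caps.1. Qed.

Let gain_le n : E (fun w => g (w n).1) <= dot (init M) g.
Proof.
elim: n => [|n IH]; first by rewrite /E expect_init.
apply: le_trans IH; rewrite /E (@expect_next _ _ _ _ n (fun _ s => g s))//.
apply: (expect_le _ (n := n.+1)) => [||w]; [|exact: state_local|exact: row_le].
by apply: local_sum => s _; apply: localM => //; exact: transition_row_local.
Qed.

Let jump w n : R := `|g (w n.+1).1 - g (w n).1|.

Let jump_local n : local n.+2 (jump^~ n).
Proof. by move=> w v wv; rewrite /jump !wv. Qed.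

(* The concave potential [2 G x - x ^ 2] turns the supermartingale property of
   the gain into summable squared jumps, and a finite set of gains makes the
   jumps themselves summable. *)
Let jump_summable : exists C, forall m, \sum_(t < m) E (jump^~ t) <= C.
Proof.
have [G G0 gG] := finite_bound g.
(* [D] bounds the inverses of all nonzero gain differences, so a jump is at most [D] times its
   square. *)
have [D D0 gD] := finite_bound (fun x : state M * state M => (g x.1 - g x.2)^-1).
pose pot s := 2 * G * g s - g s ^+ 2.
have potB s : `|pot s| <= 3 * G ^+ 2.
  by have := gG s; rewrite /pot !ler_norml => /andP[? ?]; apply/andP; split; nra.
have jumpD w n : jump w n <= D * jump w n ^+ 2.
  rewrite /jump; set y := g _ - g _; have [->|y0] := eqVneq y 0.
    by rewrite normr0 expr0n mulr0.
  have : `|y^-1| <= D := gD ((w n.+1).1, (w n).1).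
  rewrite normfV -[leLHS]mul1r ler_pdivrMr ?normr_gt0// => h.
  by rewrite expr2 mulrA -[leLHS]mul1r ler_wpM2r.
have sq n : E (fun w => jump w n ^+ 2) + E (fun w => pot (w n.+1).1) <=
    E (fun w => pot (w n).1).
  have sl : local n.+2 (fun w => jump w n ^+ 2).
    by move=> w v /(@jump_local n) ->.
  rewrite /E -(expectD _ sl (@state_local n.+1 pot)).
  rewrite (@expect_next _ _ _ _ n (fun w s =>
    `|g s - g (w n).1| ^+ 2 + pot s)); last by move=> s w v wv; rewrite wv.
  apply: (expect_le _ (n := n.+1)) => [||w]; last first.
  (* The squares of [g s] cancel. What remains is affine in [g s] with slope
     [2 * G - 2 * g (w n).1 >= 0], so [row_le] applies. *)
  - rewrite (_ : (fun s => _) = (fun s => (2 * G - 2 * g (w n).1) * g s +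
        g (w n).1 ^+ 2 * 1)); last first.
      by apply/funext => s; rewrite real_normK ?num_real// /pot; ring.
    rewrite dot_lin dot_cst; last exact: transition_row_simplex.
    have := row_le w n; have := gG (w n).1; rewrite ler_norml /pot => /andP[? ?].
    set d := dot _ g => dg; nra.
  - exact: state_local.
  apply: local_sum => s _; apply: localM; first exact: transition_row_local.
  by move=> w v wv; rewrite wv.
exists (D * (6 * G ^+ 2)) => m.
have tel : \sum_(t < m) E (fun w => jump w t ^+ 2) + E (fun w => pot (w m).1) <=
    E (fun w => pot (w 0%N).1).
  elim: m => [|m IH]; first by rewrite big_ord0 add0r.
  by rewrite big_ord_recr /=; have := sq m; move: IH; lra.
have potE n : `|E (fun w => pot (w n).1)| <= 3 * G ^+ 2.
  by apply: (expect_norm _ (n := n.+1)) => [|w]; [exact: state_local | exact: potB].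
apply: (@le_trans _ _ (D * \sum_(t < m) E (fun w => jump w t ^+ 2))).
  rewrite mulr_sumr; apply: ler_sum => t _.
  have sl : local t.+2 (fun w => jump w t ^+ 2).
    by move=> w v /(@jump_local t) ->.
  rewrite /E -(expectZ _ _ sl); apply: (expect_le _ (n := t.+2)) => [||w].
  - exact: jump_local.
  - exact: localM.
  - exact: jumpD.
rewrite ler_wpM2l//; have := potE m; have := potE 0%N; rewrite !ler_norml.
move: tel; lra.
Qed.

Section exponential.
Context (e : R) (h : state M -> R).
Hypothesis e0 : 0 < e.
Hypothesis h_caps : forall s a, dot (val Q (s, a)) (reward M s a) +
  dot (val Q (s, a)) h <= g s + h s + e.

Let incr s a s' : R := reward M s a s' + h s' - h s - g s - 2 * e.
Let drift w T : R := \sum_(t < T) incr (w t).1 (w t).2 (w t.+1).1.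

(* [incr] has conditional mean at most [- e], so for small [l] the exponential
   of [l] times its partial sums is a supermartingale. *)
Lemma exponential_moment : exists2 l, 0 < l &
  forall T, E (fun w => expR (l * drift w T)) <= 1.
Proof.
have [G G0 gG] := finite_bound g; have [H H0 hH] := finite_bound h.
have [b b0 rb] : exists2 b, 0 <= b & forall s a s', `|reward M s a s'| <= b.
  by exists B; [exact: sumr_ge0 | exact: reward_bound].
pose C := b + 2 * H + G + 2 * e + 1; have e_gt0 := e0.
have C1 : 1 <= C by rewrite /C; lra.
have C0 : 0 < C by lra.
have eC : e <= C by rewrite /C; lra.
have incrC s a s' : `|incr s a s'| <= C.
  have := rb s a s'; have := hH s; have := hH s'; have := gG s.
  rewrite /incr /C !ler_norml; lra.
(* With this [l] the quadratic term [2 * (l * C) ^+ 2] equals [l * e], exactly what the negative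
   mean offsets; [e <= C] gives [l * C <= 1 / 2]. *)
pose l := e / (2 * C ^+ 2).
have l0 : 0 < l by rewrite divr_gt0// mulr_gt0// exprn_gt0.
have lC2 : l * (2 * C ^+ 2) = e.
  by rewrite /l divfK// gt_eqF// mulr_gt0// exprn_gt0.
have lC : l * C <= 2^-1 by nra.
exists l => // T; elim: T => [|n IH].
  rewrite /E (_ : (fun w => _) = fun=> 1) ?expect_cst//.
  by apply/funext => w; rewrite /drift big_ord0 mulr0 expR0.
apply: le_trans IH; rewrite /E.
have dl : local n.+1 (fun w => expR (l * drift w n)).
  move=> w v wv; congr (expR (_ * _)); apply: eq_bigr => t _.
  by rewrite !wv// ltnS// ltnW.
pose phi w s := expR (l * drift w n) * expR (l * incr (w n).1 (w n).2 s).
have -> : (fun w => expR (l * drift w n.+1)) = (fun w => phi w (w n.+1).1).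
  by apply/funext => w; rewrite /phi /drift big_ord_recr /= mulrDr expRD.
have lphi s : local n.+1 (phi^~ s).
  by move=> w v wv; rewrite /phi (dl w v)// wv.
rewrite (expect_next pi P lphi).
apply: (expect_le _ (n := n.+1)) => // [|w].
  apply: local_sum => s _; apply: localM; first exact: transition_row_local.
  exact: lphi.
rewrite /phi dotZ -[leRHS]mulr1 ler_wpM2l ?expR_ge0//.
have sp := transition_row_simplex P w n.
set s := (w n).1; set a := (w n).2; set p := transition_row P w n.
apply: (@le_trans _ _ (dot p (fun s' => 1 * (l * reward M s a s' + l * h s') +
    (1 - l * (h s + g s + 2 * e) + 2 * (l * C) ^+ 2) * 1))).
  apply: dot_le => // s'.
  have lincr : `|l * incr s a s'| <= l * C.
    by rewrite normrM gtr0_norm// ler_wpM2l// ltW.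
  apply: le_trans (expR_quadratic (le_trans lincr lC)) _.
  have : (l * incr s a s') ^+ 2 <= (l * C) ^+ 2.
    by rewrite -real_normK ?num_real// lerXn2r// nnegrE// mulr_ge0// ltW.
  by rewrite /incr; lra.
rewrite dot_lin dot_lin dot_cst//.
have := h_caps s a; rewrite -rowE -/p => hp.
have : l * (dot p (reward M s a) + dot p h) <= l * (g s + h s + e).
  by rewrite ler_wpM2l// ltW.
have : 2 * (l * C) ^+ 2 = l * e by rewrite -lC2; ring.
lra.
Qed.

End exponential.

(** From a late period [N] on, the gain hardly moves and the drift hardly exceeds its linear bound,
    both up to errors of small total expectation. The average is then compared with [g (w N).1],
    whose mean is at most the initial one. *)
Lemma Ravg_le : (Ravg pi P <= (dot (init M) g)%:E)%E.
Proof.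
(* Of the four [e], two come from the centring of [incr], one from the linear bound on [drift], and
   one from the tail beyond [N]. *)
apply/lee_addgt0Pr => e4 e40.
have [e e0 eE] : exists2 e, 0 < e & e4 = 4 * e.
  by exists (e4 / 4); [rewrite divr_gt0 | lra].
have [h hcap] := g_caps.2 e e0.
have [G G0 gG] := finite_bound g; have [H H0 hH] := finite_bound h.
have [l l0] := exponential_moment e0 hcap.
pose incr s a s' : R := reward M s a s' + h s' - h s - g s - 2 * e.
pose drift w T : R := \sum_(t < T) incr (w t).1 (w t).2 (w t.+1).1.
rewrite -/incr => expE.
pose q := expR (- (l * e)).
have q0 : 0 < q by exact: expR_gt0.
have q1 : q < 1 by rewrite expR_lt1 oppr_lt0 mulr_gt0.
have drift_local T : local T.+1 (fun w => expR (l * drift w T)).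
  move=> w v wv; congr (expR (_ * _)); apply: eq_bigr => t _.
  by rewrite !wv// ltnS// ltnW.
(* By [1 + x <= expR x], [drift] exceeds [e * T] by at most [bump], whose expectation decays
   geometrically thanks to [exponential_moment]. *)
pose bump w T := l^-1 * q ^+ T * expR (l * drift w T).
have bump_local T : local T.+1 (bump^~ T).
  by move=> w v wv; rewrite /bump (drift_local T w v).
have bump0 w T : 0 <= bump w T.
  by rewrite mulr_ge0 ?expR_ge0// mulr_ge0 ?invr_ge0 ?exprn_ge0// ltW.
have bumpE T : E (bump^~ T) <= l^-1 * q ^+ T.
  rewrite /E (expectZ _ _ (drift_local T)) -[leRHS]mulr1 ler_wpM2l//.
    by rewrite mulr_ge0 ?invr_ge0 ?exprn_ge0// ltW.
  exact: expE.
have drift_le w T : drift w T <= e * T%:R + bump w T.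
  rewrite -(ler_pM2l l0) mulrDr /bump !mulrA mulfV ?gt_eqF// mul1r.
  pose x := T%:R * - (l * e) + l * drift w T.
  rewrite (_ : q ^+ T * _ = expR x); last by rewrite expRD expRM_natl.
  by have := expR_ge1Dx x; rewrite /x; lra.
have [C jumpC] := jump_summable.
have [N tail] : exists N, forall m,
    \sum_(i < m) (E (jump^~ (N + i)%N) + l^-1 * q ^+ (N + i)) <= e.
  apply: (@summable_tail (fun t => E (jump^~ t) + l^-1 * q ^+ t)
      (C + l^-1 * (1 - q)^-1)) => // [n|n].
    rewrite addr_ge0//; first by apply: Rintegral_ge0 => w _; exact: normr_ge0.
    by rewrite mulr_ge0 ?invr_ge0 ?exprn_ge0// ltW.
  rewrite big_split /= -mulr_sumr; apply: lerD; first exact: jumpC.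
  rewrite ler_wpM2l ?invr_ge0 ?(ltW l0)//.
  have q10 : 0 < 1 - q by rewrite subr_gt0.
  rewrite -[leRHS]mul1r ler_pdivlMr// mulrC -opprB mulNr -subrX1 opprB.
  by rewrite lerBlDr lerDl exprn_ge0// ltW.
pose f i w := jump w (N + i) + bump w (N + i).
have f_local i : local (N + i).+2 (f i).
  by apply: localD; [exact: jump_local | apply: localW (bump_local _)].
have f0 i w : 0 <= f i w by rewrite addr_ge0 ?normr_ge0.
have rew_sum w T : \sum_(t < T) rew w t =
    drift w T + h (w 0%N).1 - h (w T).1 + \sum_(t < T) g (w t).1 + 2 * e * T%:R.
  elim: T => [|T IH]; first by rewrite /drift !big_ord0; ring.
  rewrite /drift !big_ord_recr /= IH /drift /incr /rew -[T.+1%:R]natr1; ring.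
have climb w i k : (i <= k)%N ->
    g (w (N + i)%N).1 <= g (w N).1 + \sum_(j < k) jump w (N + j).
  move=> ik; apply: (@le_trans _ _ (g (w N).1 + \sum_(j < i) jump w (N + j))).
    elim: i {ik} => [|i IH]; first by rewrite big_ord0 addn0 addr0.
    rewrite big_ord_recr /= addnS /jump; move: IH.
    have := ler_norm (g (w (N + i).+1).1 - g (w (N + i)%N).1); rewrite /jump; lra.
  rewrite lerD2l -(subnKC ik) big_split_ord /= lerDl sumr_ge0// => j _.
  exact: normr_ge0.
have path_bound w n : (N <= n)%N -> exists m, average w n <=
    g (w N).1 + \sum_(i < m) f i w + 3 * e + (2 * H + 2 * G * N%:R) / n.+1%:R.
  move=> Nn; pose k := (n.+1 - N)%N.
  have nk : n.+1 = (N + k)%N by rewrite /k subnKC// ltnW.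
  (* [k.+1] terms, so that the bump at the final time [N + k] is included. *)
  exists k.+1; rewrite /average ler_pdivrMr// [leRHS]mulrDl divfK// rew_sum.
  rewrite nk; set y := g (w N).1 + \sum_(j < k.+1) jump w (N + j).
  pose S := \sum_(i < k.+1) bump w (N + i).
  have -> : \sum_(i < k.+1) f i w = \sum_(j < k.+1) jump w (N + j) + S.
    by rewrite -big_split.
  (* The first [N] gains are bounded crudely, at a cost of [2 * G] each that vanishes in the
     average; the later ones by [climb]. *)
  have gy : \sum_(t < N + k) g (w t).1 <= N%:R * (y + 2 * G) + k%:R * y.
    rewrite big_split_ord /= lerD//.
      rewrite [leRHS](_ : _ = \sum_(t < N) (y + 2 * G)); last first.
        by rewrite sumr_const card_ord mulr_natl.
      apply: ler_sum => t _; have := gG (w t).1; have := gG (w N).1.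
      rewrite !ler_norml /y => /andP[gN _] /andP[_ gt].
      have : 0 <= \sum_(j < k.+1) jump w (N + j).
        by apply: sumr_ge0 => j _; exact: normr_ge0.
      lra.
    rewrite [leRHS](_ : _ = \sum_(t < k) y); last first.
      by rewrite sumr_const card_ord mulr_natl.
    apply: ler_sum => t _; apply: climb; exact: leqW (ltnW (ltn_ord t)).
  have bS : bump w (N + k) <= S * (N + k)%:R.
    have S0 k' : 0 <= \sum_(i < k') bump w (N + i).
      by apply: sumr_ge0 => i _; exact: bump0.
    apply: (@le_trans _ _ S); first by rewrite /S big_ord_recr /= lerDr S0.
    by rewrite ler_peMr ?S0// -nk ler1n.
  have := drift_le w (N + k)%N; have := hH (w 0%N).1; have := hH (w (N + k)%N).1.
  rewrite !ler_norml => /andP[h1 _] /andP[_ h2] dle.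
  have -> : (g (w N).1 + (\sum_(j < k.+1) jump w (N + j) + S) + 3 * e) * (N + k)%:R
     = y * N%:R + y * k%:R + S * (N + k)%:R + 3 * e * (N + k)%:R.
    by rewrite natrD /y; ring.
  move: gy dle bS; lra.
apply: le_trans (@limsup_integral_le _ _ _ (law pi P) (fun n w => average w n) B
  _ _ (fun w => g (w N).1) f N G (3 * e) (2 * H + 2 * G * N%:R) e _ _ _ _ _ _ _ _) _.
- by move=> n; exact: local_measurable (@average_local n).
- exact: average_bound.
- exact: local_measurable (@state_local N g).
- by move=> w; exact: gG.
- by move=> i; exact: local_measurable (f_local i).
- exact: f0.
- by move=> i; exact: local_integrable (f_local i).
- move=> m; apply: le_trans (tail m); apply: ler_sum => i _.
  rewrite -[leLHS]/(E (f i)) /E (expectD _ (@jump_local _) (localW _ (bump_local _)))//.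
  rewrite lerD2l; exact: bumpE.
- by rewrite addr_ge0// mulr_ge0// mulr_ge0.
- exact: path_bound.
rewrite -EFinD lee_fin -[X in X + e + _]/(E (fun w => g (w N).1)).
by have := gain_le N; rewrite eE; lra.
Qed.
End upper_bound.
End average_return.

(** * Equality of the two optimal values *)

Theorem theorem3p6 (R : realType) (M : rmdp R)
  (U_rect : sa_rectangular M) (U_compact : compact (uset M)) :
  ereal_sup (range (fun pi : policy M =>
    ereal_inf (range (fun P : adversary M => Ravg pi P)))) =
  ereal_sup (range (fun pi : policy M =>
    ereal_inf (range (fun P : nature M => Ravg pi (stationary P))))).
Proof.
have [K [K_simplex UE]] := U_rect.
have [g [sigma [sigma_g approx]]] := compact_game (sa_point M).2
  (@reward_bound _ M) K_simplex UE U_compact (@uset_neq0 _ M).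
apply/eqP; rewrite eq_le; apply/andP; split.
  apply: ge_ereal_sup => _ [pi _ <-].
  apply: le_trans (ereal_sup_ubound _); last by exists pi.
  apply: le_ereal_inf_tmp => _ [Q _ <-].
  by apply: ereal_inf_lbound; exists (stationary Q).
(* The mean initial gain separates the two sides: the caps keep the stationary side below it, and
   [sigma] secures it against every adversary. *)
apply: (@le_trans _ _ (dot (init M) g)%:E).
  apply: ge_ereal_sup => _ [pi _ <-]; apply/lee_addgt0Pr => e e0.
  have [P [w [KP P_caps wg]]] := approx e e0.
  have UP : uset M (fun sa => P sa.1 sa.2) by rewrite UE => s a; exact: KP.
  pose Q : nature M := SigSub (mem_set UP).
  apply: (@le_trans _ _ (Ravg pi (stationary Q))).
    by apply: ereal_inf_lbound; exists Q.
  apply: le_trans (Ravg_le pi (Q := Q) P_caps) _.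
  rewrite -EFinD lee_fin; apply: dot_le_add => //; exact: init_simplex.
apply: le_trans (ereal_sup_ubound _); last by exists (stationary_policy sigma).
apply: le_ereal_inf_tmp => _ [P _ <-].
apply: (Ravg_ge _ (K := K)) => // Q s a.
by have /set_mem := valP Q; move: (val Q) => P'; rewrite UE; apply.
Qed.
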